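(* Let $\Gamma$ be an infinite compact connected metrizable abelian group and $\Lambda$ be a finite subgroup of $\Gamma$. Let $Z$ be a compact metrizable space and $G_a$ be an arc-wise connected subgroup of $\mathcal H(Z)$ with a minimal natural action on $Z$. Let $N(G_a)$ be the normalizer of $G_a$ in $\mathcal H(Z)$. If $q\colon\Lambda\to N(G_a)$ is a morphism of groups, then the orbit space $(\Gamma\times Z)/\Lambda$, obtained from $\Gamma\times Z$ by applying the diagonal action $\lambda\cdot(\gamma,z)=(\lambda\gamma,q(\lambda)(z))$ of $\Lambda$, is homeo-product-minimal.
   Context: $\mathcal H(Z)$ is the group of all homeomorphisms of $Z$ with the topology of uniform convergence, and its subgroups carry the induced topology. The natural action of $G_a$ on $Z$ is $(g,z)\mapsto g(z)$; it is minimal if every orbit is dense. $N(G_a)$ is the set of $h\in\mathcal H(Z)$ such that $hgh^{-1}\in G_a$ for every $g\in G_a$, as usual for the normalizer of $G_a$ in $\mathcal H(Z)$. A dynamical system $(X,T)$ ($X$ metrizable, $T\colon X\to X$ continuous) is minimal if there is no proper nonempty closed $M\subsetneq X$ with $T(M)\subseteq M$. A compact metrizable space $Y$ is homeo-product-minimal if for every minimal system $(X,T)$ with $X$ metrizable, not necessarily compact, there is a homeomorphism $S\colon Y\to Y$ such that $(X\times Y,T\times S)$ is minimal. *)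

(* Defs.v *)
From HB Require Import structures.
From mathcomp Require Export all_boot all_order all_algebra.
From mathcomp Require Export generic_quotient.
From mathcomp Require Export all_classical all_reals all_analysis.
Export numFieldNormedType.Exports.

Set Implicit Arguments.
Unset Strict Implicit.
Unset Printing Implicit Defensive.
Import Order.TTheory GRing.Theory Num.Theory.

#[global] Open Scope classical_set_scope.
#[global] Open Scope ring_scope.
Local Open Scope quotient_scope.

Definition homeomorphism (X Y : topologicalType) (f : X -> Y) : Prop :=
  exists g : Y -> X,
    [/\ continuous f, continuous g, cancel f g & cancel g f].

Definition metrizable (R : realType) (T : topologicalType) : Prop :=
  exists (M : metricType R) (f : T -> M), homeomorphism f.

(* An arc in A from x to y is a homeomorphic image of [0, 1]; k is the inverse
   of the parametrization f. *)
Definition arcwise_connected (R : realType) (T : topologicalType) (A : set T) :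
    Prop :=
  forall x y : T, A x -> A y -> x <> y ->
  exists (f : R -> T) (k : T -> R),
    [/\ {within `[0, 1], continuous f},
        {within f @` `[0, 1], continuous k},
        (forall t : R, 0 <= t <= 1 -> k (f t) = t) &
        [/\ f @` `[0, 1] `<=` A, f 0 = x & f 1 = y]].

(* Subgroups of the homeomorphism group of Z are sets of maps Z -> Z.  Viewed as
   sets in {uniform Z -> Z}, they carry the topology of uniform convergence
   (independent of the choice of a compatible metric when Z is compact). *)
Section HomeomorphismGroups.
Variable Z : topologicalType.
Implicit Types (G : set (Z -> Z)) (g h k : Z -> Z).

Definition homeo_subgroup G : Prop :=
  [/\ G `<=` @homeomorphism Z Z,
      G id,
      (forall g h, G g -> G h -> G (g \o h)) &
      (forall g k, G g -> cancel g k -> cancel k g -> G k)].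

Definition minimal_action G : Prop := forall z : Z, dense [set g z | g in G].

Definition homeo_normalizer G : set (Z -> Z) :=
  [set h | homeomorphism h /\
    forall g k, G g -> cancel h k -> cancel k h -> G (h \o g \o k)].

End HomeomorphismGroups.

(* Orbit space of the maps act l, l in L: points are identified when they have
   the same orbit, which is an equivalence relation for any family act. *)
Section OrbitSpace.
Variables (X : topologicalType) (I : Type) (L : set I) (act : I -> X -> X).

Definition orbit_of (x : X) : set X := [set act l x | l in L].

Definition same_orbit : rel X := fun x y => `[< orbit_of x = orbit_of y >].

Lemma same_orbit_refl : reflexive same_orbit.
Proof. by move=> x; apply/asboolP. Qed.

Lemma same_orbit_sym : symmetric same_orbit.
Proof. by move=> x y; apply/asboolP/asboolP => ->. Qed.

Lemma same_orbit_trans : transitive same_orbit.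
Proof. by move=> y x z /asboolP xy /asboolP yz; apply/asboolP; rewrite xy. Qed.

Canonical same_orbit_equiv :=
  EquivRel same_orbit same_orbit_refl same_orbit_sym same_orbit_trans.

Definition orbit_space : topologicalType :=
  quotient_topology {eq_quot same_orbit_equiv}.

End OrbitSpace.

(* Only the values q l with l in the acting subgroup of G matter. *)
Definition diagonal_map (G : zmodType) (Z : Type) (q : G -> Z -> Z) (l : G)
  (p : G * Z) : G * Z := (l + p.1, q l p.2).

Definition minimal_system (X : topologicalType) (T : X -> X) : Prop :=
  continuous T /\
  forall M : set X, closed M -> M !=set0 -> T @` M `<=` M -> M = [set: X].

Definition homeo_product_minimal (R : realType) (Y : topologicalType) : Prop :=
  [/\ compact [set: Y], metrizable R Y &
      forall (X : topologicalType) (T : X -> X),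
        metrizable R X -> minimal_system T ->
        exists2 S : Y -> Y, homeomorphism S &
          minimal_system (fun p : X * Y => (T p.1, S p.2))].

(* Main.v *)
Require Import Defs.
From HB Require Import structures.
From mathcomp Require Import lra ring.

Set Implicit Arguments.
Unset Strict Implicit.
Unset Printing Implicit Defensive.
Import Order.TTheory GRing.Theory Num.Theory.

(** The factor [X] of a product need not be compact, so everything is reduced to
    return times of one point.  If [x0] is a point of a minimal system, the sets
    [A i] of times after [i] at which [x0] is back within [1 / i.+1] of itself are
    infinite.  It is enough to find, for arbitrary infinite sets of times [A i], a
    homeomorphism [S] of the compact space [Y] such that every [S]-orbit, looked at
    only at the times in [A i], is dense in [Y] up to an error tending to zero with
    [i].  A closed invariant subset of the product then contains a fibre, and so is
    the whole product ([product_minimal]).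

    The homeomorphism is induced on the orbit space by one of [Gamma * Z] that
    commutes with the finite group.  The latter is a uniform limit of maps
    [H^-1 \o rot g \o H], with [rot g] the rotation by [g] in [Gamma] and [H] an
    equivariant homeomorphism.  By a Baire category argument
    ([generic_equivariant_homeomorphism]) it is enough to perturb a rotation
    [rot g0] within this class, as little as desired, so that every orbit visits a
    given open set at a time in a given infinite set ([rotation_perturbation]).  The
    perturbation is the conjugate of [rot g] by [(x, z) |-> (x, K' (x *+ n) z)],
    where [K] is an equivariant family of homeomorphisms of [Z], with inverses [K'],
    assembled from a path in [Ga] through finitely many elements that together move
    every point of [Z] into the open set ([hitting_cocycle]); such elements exist by
    minimality of the action.

    Everything thus rests on the behaviour of [x |-> x *+ n] on [Gamma] for large
    [n]: it maps every ball onto a set that is nearly dense ([multiples_mixing]).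
    With characters this would be a computation with trigonometric polynomials; here
    it is proved for totally bounded seminorms on abelian groups whose balls
    generate.  Given an ultrafilter [U] of integers tending to infinity, let [phi] be
    the distance to the subgroup of limits along [U] of [w *+ n] with [w] tending to
    zero.  For [phi] the maps [x |-> x *+ n] are equicontinuous, and they converge on
    finite sets, so differences of two integers [n] give [N > 0] with [x *+ N]
    uniformly [phi]-small.  It remains to see that the group is not far from its
    [N]-th multiples, that is, that a seminorm vanishing on [N]-th multiples is zero
    ([torsion_seminorm_trivial]).  The group is then approximated by finite groups of
    exponent [N], on which convolution by the seminorm is a self-adjoint operator.
    Its iterates on a suitable function of mean zero decay no faster than geometrically, at a
    ratio that does not depend on the approximation, whereas exponent [N] and
    generation by a tiny ball force them to decay as fast as desired
    ([conv_growth_le_exponent]). *)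

(** * Seminorms on abelian groups *)

Definition group_seminorm (R : realType) (G : zmodType) (rho : G -> R) :=
  [/\ rho 0 = 0, (forall x, rho (- x) = rho x) &
      forall x y, rho (x + y) <= rho x + rho y].

Section Seminorm.
Variables (R : realType) (G : zmodType) (rho : G -> R).
Hypothesis rhoP : group_seminorm rho.

Lemma sn0 : rho 0 = 0. Proof. by case: rhoP. Qed.
Lemma snN x : rho (- x) = rho x. Proof. by case: rhoP. Qed.
Lemma snD x y : rho (x + y) <= rho x + rho y. Proof. by case: rhoP. Qed.

Lemma snB x y : rho (x - y) <= rho x + rho y.
Proof. by rewrite -(snN y) snD. Qed.

Lemma snBC x y : rho (x - y) = rho (y - x).
Proof. by rewrite -snN opprB. Qed.

Lemma sn_tri y x z : rho (x - z) <= rho (x - y) + rho (y - z).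
Proof. by rewrite -[x - z](subrKA y) snD. Qed.

Lemma sn_ge0 x : 0 <= rho x.
Proof. by have := snB x x; rewrite subrr sn0; lra. Qed.

Lemma sn_lip x y : `|rho x - rho y| <= rho (x - y).
Proof.
have h1 := snD (x - y) y; have h2 := snD (y - x) x.
rewrite !subrK in h1 h2; rewrite (snBC y) in h2.
by rewrite ler_norml; apply/andP; split; lra.
Qed.

Lemma snMn x n : rho (x *+ n) <= n%:R * rho x.
Proof.
elim: n => [|n IH]; first by rewrite mulr0n sn0 mul0r.
by rewrite mulrS (le_trans (snD _ _))// -natr1 mulrDl mul1r addrC lerD2r.
Qed.

End Seminorm.

(** * Convolution by a seminorm on a finite group *)

Lemma Cauchy_Schwarz_sum (R : realDomainType) (I : finType) (a b : I -> R) :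
  (\sum_i a i * b i) ^+ 2 <= (\sum_i a i ^+ 2) * (\sum_i b i ^+ 2).
Proof.
have: 0 <= \sum_i \sum_j (a i * b j - a j * b i) ^+ 2.
  by apply: sumr_ge0 => i _; apply: sumr_ge0 => j _; exact: sqr_ge0.
have -> : \sum_i \sum_j (a i * b j - a j * b i) ^+ 2 =
    (\sum_i \sum_j a i ^+ 2 * b j ^+ 2) + (\sum_i \sum_j b i ^+ 2 * a j ^+ 2)
    - (\sum_i \sum_j (a i * b i) * (a j * b j)) *+ 2.
  rewrite -sumrMnl -big_split -sumrB; apply: eq_bigr => i _ /=.
  rewrite -sumrMnl -big_split -sumrB; apply: eq_bigr => j _ /=.
  by ring.
under [X in X + _ - _]eq_bigr do rewrite -mulr_sumr.
under [X in _ + X - _]eq_bigr do rewrite -mulr_sumr.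
under [X in _ - X *+ _]eq_bigr do rewrite -mulr_sumr.
by rewrite -!mulr_suml; nra.
Qed.

Lemma geometric_lt (R : realType) (B a q : R) :
  0 < a -> 0 <= q < 1 -> exists n, B * q ^+ n < a.
Proof.
move=> a0 /andP[q0 q1].
have /(@cvg_geometric R B) : `|q| < 1 by rewrite ger0_norm.
move=> /(@cvgr0Pnorm_lt _ _ _ _)/(_ _ a0)[n _ /(_ n (leqnn n))] /= h.
by exists n; apply: le_lt_trans h; exact: ler_norm.
Qed.

Section FiniteGroup.
Variables (R : realType) (P : finZmodType) (rho : P -> R) (N : nat).
Hypothesis rhoP : group_seminorm rho.
Hypothesis N_gt0 : (0 < N)%N.
Hypothesis expN : forall x : P, x *+ N = 0.

Let card0 : 0 < #|P|%:R :> R.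
Proof. by rewrite ltr0n; apply/card_gt0P; exists 0. Qed.

Definition conv (h : P -> R) (x : P) : R :=
  #|P|%:R^-1 * \sum_y rho (x - y) * h y.

Definition diff (t : P) (h : P -> R) (x : P) : R := h (x + t) - h x.

Lemma conv_shift h t x : conv h (x + t) = conv (fun y => h (y + t)) x.
Proof.
rewrite /conv; congr (_ * _); rewrite (reindex_inj (addIr t)) /=.
by apply: eq_bigr => y _; rewrite opprD addrACA subrr addr0.
Qed.

Lemma convB h k x : conv (fun y => h y - k y) x = conv h x - conv k x.
Proof.
rewrite /conv -mulrBr -sumrB; congr (_ * _).
by apply: eq_bigr => y _; rewrite mulrBr.
Qed.

Lemma diff_conv t h x : diff t (conv h) x = conv (diff t h) x.
Proof. by rewrite /diff convB conv_shift. Qed.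

Lemma mean_bound (u : P -> R) C : (forall y, `|u y| <= C) ->
  `|#|P|%:R^-1 * \sum_y u y| <= C.
Proof.
move=> hC; have c0 : 0 <= #|P|%:R^-1 :> R by rewrite invr_ge0 ltW.
rewrite normrM (ger0_norm c0) [leLHS]mulrC ler_pdivrMr//.
rewrite (le_trans (ler_norm_sum _ _ _))//.
rewrite (le_trans (ler_sum _ (fun i _ => hC i)))//.
by rewrite sumr_const mulr_natr.
Qed.

Lemma conv_modulus h C t x : (forall y, `|h y| <= C) ->
  `|conv h (x + t) - conv h x| <= rho t * C.
Proof.
move=> hC; rewrite /conv -mulrBr -sumrB; apply: mean_bound => y.
rewrite -mulrBl normrM ler_pM//.
apply: le_trans (sn_lip rhoP _ _) _.
by rewrite opprB addrA subrK addrC addKr.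
Qed.

(** The place where the exponent enters.  For [v] the difference of [conv h]
    along [t], the sum of [v] over the [N] translates by multiples of [t]
    telescopes to zero, so [N * v] is a sum of differences of [v] along multiples
    of [t].  Since [v] is itself a convolution, of [diff t h], each of these is at
    most [N * rho t * C]. *)
Lemma diff_conv_bound h t C : (forall x, `|diff t h x| <= C) ->
  forall x, `|diff t (conv h) x| <= N%:R * rho t * C.
Proof.
move=> hC x; set v := diff t (conv h).
have C0 : 0 <= C by apply: le_trans (hC 0).
have sumv : \sum_(0 <= i < N) v (x + t *+ i) = 0.
  transitivity (\sum_(0 <= i < N) (conv h (x + t *+ i.+1) - conv h (x + t *+ i))).
    by apply: eq_bigr => i _; rewrite /v /diff mulrSr addrA.
  by rewrite telescope_sumr// expN mulr0n subrr.
have Nv : N%:R * v x = \sum_(0 <= i < N) (v x - v (x + t *+ i)).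
  by rewrite sumrB sumv subr0 sumr_const_nat subn0 mulr_natl.
have N0 : 0 < N%:R :> R by rewrite ltr0n.
rewrite -(ler_pM2l N0) -[X in X * `|_| <= _](ger0_norm (ltW N0)) -normrM Nv.
rewrite (le_trans (ler_norm_sum _ _ _))//.
have -> : N%:R * (N%:R * rho t * C) = \sum_(0 <= i < N) (N%:R * rho t * C).
  by rewrite sumr_const_nat subn0 mulr_natl.
rewrite big_nat_cond [leRHS]big_nat_cond; apply: ler_sum => i.
rewrite andbT => /andP[_ iN]; rewrite distrC {1 2}/v !diff_conv.
apply: le_trans (conv_modulus _ _ hC) _; rewrite ler_wpM2r//.
rewrite (le_trans (snMn rhoP _ _))// ler_wpM2r ?(sn_ge0 rhoP)//.
by rewrite ler_nat ltnW.
Qed.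

Lemma diff_iter_bound f t C n : (forall x, `|diff t f x| <= C) ->
  forall x, `|diff t (iter n conv f) x| <= (N%:R * rho t) ^+ n * C.
Proof.
move=> hC; elim: n => [|n IH] x; first by rewrite expr0 mul1r.
by rewrite exprS -mulrA; apply: diff_conv_bound.
Qed.

Lemma sum_conv h : \sum_x conv h x = (#|P|%:R^-1 * \sum_x rho x) * \sum_x h x.
Proof.
rewrite /conv -mulr_sumr -mulrA; congr (_ * _); rewrite exchange_big mulr_sumr /=.
apply: eq_bigr => y _; rewrite -mulr_suml; congr (_ * _).
by rewrite (reindex_inj (addIr y)) /=; apply: eq_bigr => x _; rewrite addrK.
Qed.

Definition dotp (h k : P -> R) : R := \sum_x h x * k x.

Lemma conv_sym h k : dotp (conv h) k = dotp h (conv k).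
Proof.
rewrite /dotp /conv.
under eq_bigr do rewrite -mulrA mulr_suml.
under [RHS]eq_bigr do rewrite mulrCA mulr_sumr.
rewrite -!mulr_sumr exchange_big; congr (_ * _).
apply: eq_bigr => x _; apply: eq_bigr => y _.
by rewrite (snBC rhoP) mulrAC mulrC.
Qed.

(** [conv] is self-adjoint, so by Cauchy-Schwarz the squared norms of the iterates
    of [conv] on [f] form a log-convex sequence: they grow at least as fast as
    their first ratio. *)
Lemma dotp_iter_growth f c : 0 < dotp f f ->
  c * dotp f f <= dotp (conv f) (conv f) -> 0 < c -> forall n,
  c ^+ n * dotp f f <= dotp (iter n conv f) (iter n conv f).
Proof.
move=> f0 hc c0.
pose a n := dotp (iter n conv f) (iter n conv f).
have ratio n : 0 < a n /\ c * a n <= a n.+1.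
  elim: n => [|n [an0 IH]]; first by [].
  have an10 : 0 < a n.+1 by apply: lt_le_trans IH; exact: mulr_gt0.
  split=> //.
  have CS : a n.+1 ^+ 2 <= a n * a n.+2.
    rewrite {1}/a [iter n.+1 conv f]iterS conv_sym.
    apply: le_trans (Cauchy_Schwarz_sum _ _) _.
    by rewrite le_eqVlt; apply/orP; left; apply/eqP; congr (_ * _);
      apply: eq_bigr => x _; rewrite expr2.
  rewrite -(ler_pM2l an0); apply: le_trans CS.
  by rewrite mulrCA mulrA expr2 ler_wpM2r// ltW.
elim=> [|n IH]; first by rewrite expr0 mul1r.
rewrite exprS -mulrA; apply: le_trans (proj2 (ratio n)).
by rewrite ler_wpM2l// ltW.
Qed.

(** If [N * eta < c], the differences of the iterate [conv^n f] along any element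
    decay like [(N * eta) ^ n], because they do so along the generators of
    seminorm below [eta].  As [f] has mean zero, so has each iterate, which is
    therefore bounded by its own differences and decays at the same rate.  This
    contradicts the growth of order at least [c ^ n]. *)
Lemma conv_growth_le_exponent (eta c : R) (f : P -> R) :
  (forall x, exists s : seq P, all (fun t => rho t < eta) s /\ x = \sum_(t <- s) t) ->
  0 < c -> 0 < eta -> \sum_x f x = 0 -> 0 < dotp f f ->
  c ^+ 2 * dotp f f <= dotp (conv f) (conv f) -> c <= N%:R * eta.
Proof.
move=> gen c0 eta0 sumf f0 Kf; rewrite leNgt; apply/negP => etac.
pose C := \sum_x `|f x|.
have fC x : `|f x| <= C.
  by rewrite /C (bigD1 x)//= lerDl sumr_ge0.
have dC t x : `|diff t f x| <= C *+ 2.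
  by rewrite mulr2n (le_trans (ler_normB _ _))// lerD.
have C0 : 0 <= C by apply: le_trans (fC 0).
pose b n := (N%:R * eta) ^+ n * (C *+ 2).
have Neta0 : 0 <= N%:R * eta by rewrite mulr_ge0 // ltW.
have b0 n : 0 <= b n by rewrite mulr_ge0 ?exprn_ge0// mulrn_wge0.
have gen_bound s n x : all (fun t => rho t < eta) s ->
    `|diff (\sum_(t <- s) t) (iter n conv f) x| <= (size s)%:R * b n.
  elim: s x => [|t s IH] x /=; first by rewrite big_nil /diff addr0 subrr normr0 mul0r.
  move=> /andP[ht hs]; rewrite big_cons.
  have -> g : diff (t + \sum_(j <- s) j) g x =
     diff (\sum_(j <- s) j) g (x + t) + diff t g x.
    by rewrite /diff addrA subrKA.
  rewrite (le_trans (ler_normD _ _))// -natr1 mulrDl mul1r lerD ?IH//.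
  apply: le_trans (diff_iter_bound _ (dC t) x) _; rewrite ler_wpM2r ?mulrn_wge0//.
  rewrite lerXn2r// ?nnegrE ?mulr_ge0 ?(sn_ge0 rhoP)//.
  by rewrite ler_wpM2l// ltW.
have [l hl] := choice gen.
pose m := \sum_x (size (l x))%:R : R.
have m0 : 0 <= m by apply: sumr_ge0.
have sumK n : \sum_x iter n conv f x = 0.
  by elim: n => [//|n IH]; rewrite iterS sum_conv IH mulr0.
have sup n x : `|iter n conv f x| <= m * b n.
  have -> : iter n conv f x = - (#|P|%:R^-1 * \sum_t diff t (iter n conv f) x).
    rewrite /diff sumrB; have -> : \sum_t iter n conv f (x + t) = 0.
      by rewrite -[RHS](sumK n) [RHS](reindex_inj (addrI x)) /=.
    by rewrite sub0r mulrN opprK sumr_const -[X in _ * X]mulr_natl mulKf// gt_eqF.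
  rewrite normrN; apply: mean_bound => t; have [h1 h2] := hl t.
  rewrite {1}h2; apply: le_trans (gen_bound _ _ _ h1) _.
  by rewrite ler_wpM2r// /m (bigD1 t)//= lerDl sumr_ge0.
have up n : dotp (iter n conv f) (iter n conv f) <= #|P|%:R * (m * b n) ^+ 2.
  rewrite mulr_natl -sumr_const; apply: ler_sum => x _.
  rewrite -expr2 -real_normK ?num_real// lerXn2r// ?nnegrE//.
  by rewrite mulr_ge0.
have low := dotp_iter_growth f0 Kf (exprn_gt0 2 c0).
pose q := (N%:R * eta / c) ^+ 2.
have q0 : 0 <= N%:R * eta / c by rewrite divr_ge0// ltW.
have q01 : 0 <= q < 1.
  by rewrite exprn_ge0//= expr_lt1// ltr_pdivrMr// mul1r.
have [n] := geometric_lt (#|P|%:R * (m * (C *+ 2)) ^+ 2) f0 q01.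
rewrite ltNge => /negP; apply.
have cn : 0 < (c ^+ 2) ^+ n by rewrite !exprn_gt0.
rewrite -(ler_pM2l cn); apply: le_trans (low n) _; apply: le_trans (up n) _.
rewrite le_eqVlt; apply/orP; left; apply/eqP.
rewrite /b /q !exprMn !exprVn; field.
by rewrite expf_neq0 ?gt_eqF.
Qed.

End FiniteGroup.

(** * Seminorms vanishing on multiples *)

Definition totally_bounded_sn (R : realType) (G : zmodType) (rho : G -> R) :=
  forall e : R, 0 < e -> exists s : seq G, forall x, exists2 f, f \in s & rho (x - f) < e.

(** In a topological group, what connectedness leaves of itself at every scale:
    each ball around zero generates the group. *)
Definition chainable (R : realType) (G : zmodType) (rho : G -> R) :=
  forall e : R, 0 < e -> forall x,
  exists s : seq G, all (fun t => rho t < e) s /\ x = \sum_(t <- s) t.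

Lemma sn_eq (R : realType) (G : zmodType) (rho : G -> R) x y :
  group_seminorm rho -> rho (x - y) = 0 -> rho x = rho y.
Proof.
move=> rhoP xy; have := sn_lip rhoP x y.
by rewrite xy normr_le0 subr_eq0 => /eqP.
Qed.

(** A group of exponent [n.+2] up to elements of seminorm zero is approximated by
    the finite groups of combinations, with coefficients modulo [n.+2], of finitely
    many of its elements.  The map [comb] is additive up to seminorm zero, so
    [rho \o comb] is again a seminorm. *)
Section FiniteApproximation.
Variables (R : realType) (G : zmodType) (rho : G -> R) (n : nat).
Hypothesis rhoP : group_seminorm rho.
Hypothesis expN : forall x, rho (x *+ n.+2) = 0.
Variable F : seq G.

Let k := size F.
Let P : finZmodType := 'rV['I_n.+2]_k.

Let Fi (i : 'I_k) := nth 0 F i.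

Definition comb (v : P) : G := \sum_i Fi i *+ (v ord0 i : nat).

Lemma sn_sum0 (g : 'I_k -> G) : (forall i, rho (g i) = 0) -> rho (\sum_i g i) = 0.
Proof.
move=> g0; elim/big_ind: _ => //; first exact: sn0.
move=> x y x0 y0; apply/eqP; rewrite eq_le sn_ge0// andbT.
by rewrite (le_trans (snD rhoP _ _))// x0 y0 addr0.
Qed.

Lemma combD u v : rho (comb u + comb v - comb (u + v)) = 0.
Proof.
rewrite /comb -big_split -sumrB /=; apply: sn_sum0 => i.
rewrite mxE -mulrnDr /= {1}(divn_eq (u ord0 i + v ord0 i) n.+2).
by rewrite mulrnDr addrK mulrnA expN.
Qed.

Lemma comb0 : comb 0 = 0.
Proof. by apply: big1 => i _; rewrite mxE. Qed.

Lemma sn_combB u v : rho (comb (u - v)) = rho (comb u - comb v).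
Proof.
apply/esym/(sn_eq rhoP); have := combD (u - v) v.
rewrite subrK -(snN rhoP) opprB => <-; congr rho.
by rewrite [comb (u - v) + _]addrC opprD addrA.
Qed.

Lemma sn_comb : group_seminorm (rho \o comb).
Proof.
have N z : rho (comb (- z)) = rho (comb z).
  by rewrite -(snN rhoP (comb z)) -(sub0r z) sn_combB comb0 sub0r.
split=> [|x|x y] /=; [by rewrite comb0 (sn0 rhoP) | exact: N |].
by rewrite -[y in x + y]opprK sn_combB -(N y) (snB rhoP).
Qed.

Definition unit_vec (i : 'I_k) : P := \row_j (if j == i then inZp 1 else 0).

Lemma comb_unit i : comb (unit_vec i) = Fi i.
Proof.
rewrite /comb (bigD1 i)//= big1 ?mxE ?eqxx ?addr0//= => j /negPf ji.
by rewrite mxE ji.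
Qed.

(** Small balls still generate the approximating group: the partial sums of a chain
    of small steps are replaced by nearby elements of the net [F], which enlarges
    the steps at most threefold. *)
Lemma comb_gen eta : chainable rho ->
  0 < eta -> (forall x, exists2 f, f \in F & rho (x - f) < eta / 3%:R) ->
  forall u : P, exists s : seq P,
    all (fun t => (rho \o comb) t < eta) s /\ u = \sum_(t <- s) t.
Proof.
move=> ch eta0 net u.
have e30 : 0 < eta / 3%:R by rewrite divr_gt0.
suff approx (T : seq G) : all (fun t => rho t < eta / 3%:R) T ->
    exists s : seq P, all (fun t => (rho \o comb) t < eta) s /\
      rho (comb (\sum_(t <- s) t) - \sum_(t <- T) t) < eta / 3%:R.
  have [T [/approx[s [hs1 hs2]] uT]] := ch _ e30 (comb u).
  exists (u - \sum_(t <- s) t :: s); rewrite /= hs1 andbT big_cons subrK; split=> //.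
  by rewrite sn_combB uT (snBC rhoP) (lt_trans hs2)//; lra.
elim: T => [_|t T IH /= /andP[ht /IH[s [hs1 hs2]]]].
  by exists [::]; rewrite !big_nil comb0 subr0 (sn0 rhoP).
have [f fF hf] := net (t + \sum_(t <- T) t).
have fk : (index f F < k)%N by rewrite index_mem.
pose i := Ordinal fk.
have Fif : Fi i = f by rewrite /Fi nth_index.
exists (unit_vec i - \sum_(t <- s) t :: s); rewrite /= hs1 andbT !big_cons subrK.
rewrite sn_combB comb_unit Fif; split; last by rewrite (snBC rhoP).
have h1 := sn_tri rhoP (t + \sum_(t <- T) t) f (comb (\sum_(t <- s) t)).
have h2 := snD rhoP t (\sum_(t <- T) t - comb (\sum_(t <- s) t)).
rewrite addrA in h2; rewrite (snBC rhoP) in hs2; rewrite (snBC rhoP) in hf.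
by lra.
Qed.

(** The density of a ball in the approximating group is bounded below independently
    of [F]: the cells cut out by the [r / 2]-net [S] cover the group, and
    subtracting a point of a cell maps that cell into the ball. *)
Lemma comb_ball_card (r : R) (S : seq G) :
  (forall x, exists2 f, f \in S & rho (x - f) < r / 2) ->
  (#|P| <= size S * #|[pred v : P | (rho (comb v) < r)%R]|)%N.
Proof.
move=> net; set B := [pred v : P | _].
have -> : (size S * #|B|)%N = \sum_(g <- S) #|B|.
  by rewrite big_const_seq count_predT iter_addn_0 mulnC.
have le1 : (#|P| <= \sum_(v : P) \sum_(g <- S) (rho (comb v - g) < r / 2)%R)%N.
  rewrite -sum1_card; apply: leq_sum => v _.
  have [f fS hf] := net (comb v).
  by rewrite (big_rem f)//= hf.
apply: leq_trans le1 _; rewrite exchange_big /=; apply: leq_sum => g _.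
rewrite -big_mkcond sum1_card.
have [v0 /= hv0|e] := pickP (fun v => rho (comb v - g) < r / 2); last first.
  by rewrite eq_card0.
rewrite -(card_in_image (in2W (subIr v0))).
apply/subset_leq_card/fintype.subsetP => _ /fintype.imageP[v hv ->].
rewrite inE sn_combB; have := sn_tri rhoP g (comb v) (comb v0).
have hv' : rho (comb v - g) < r / 2 by [].
by rewrite (snBC rhoP g); lra.
Qed.

End FiniteApproximation.

Section TorsionSeminorm.
Variables (R : realType) (G : zmodType) (rho : G -> R) (N : nat).
Hypothesis rhoP : group_seminorm rho.
Hypothesis tb : totally_bounded_sn rho.
Hypothesis ch : chainable rho.

(** The topological content is that a compact connected abelian group of finite
    exponent is trivial.  If [rho x0 = a > 0], take for [f] the difference of the
    indicators of a ball of radius [a / 8] and of its translate by [x0].  At the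
    points of the ball, convolution by [rho] sends [f] below a negative constant
    whose size depends only on [a] and on a covering number, and this gives a growth
    ratio [c] that does not depend on the approximating group.  Choosing afterwards
    [eta] with [N * eta < c] and an approximating group that balls of radius
    [eta] generate contradicts [conv_growth_le_exponent]. *)
Lemma torsion_seminorm_trivial : (0 < N)%N -> (forall x, rho (x *+ N) = 0) ->
  forall x, rho x = 0.
Proof.
case: N => [//|[|n]] _ expN x0; first by rewrite -[x0]mulr1n.
apply/eqP; rewrite eq_le sn_ge0// andbT leNgt; apply/negP => a0.
set a := rho x0 in a0.
pose r := a / 8%:R; have r0 : 0 < r by rewrite divr_gt0.
have [S netS] := tb (divr_gt0 r0 (@ltr0n R 2)).
have S0 : 0 < (size S)%:R :> R.
  by rewrite ltr0n; have [f + _] := netS 0; case: (S).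
(* [conv f <= - a / (2 * size S)] on the ball and [dotp f f] is at most twice the
   cardinal of the ball; [c] is this size divided by 2, which leaves some room. *)
pose c := a / (size S)%:R / 4%:R.
have c0 : 0 < c by rewrite !divr_gt0.
have n0 : 0 < n.+2%:R :> R by rewrite ltr0n.
pose eta := c / n.+2%:R / 2%:R.
have eta0 : 0 < eta by rewrite !divr_gt0.
have etac : n.+2%:R * eta < c.
  by rewrite /eta mulrA [X in X / _]mulrC divfK ?gt_eqF// ltr_pdivrMr// ltr_pMr ?ltr1n.
have [T netT] := tb (divr_gt0 eta0 (@ltr0n R 3)).
(* [x0] is added to the net so that it lifts exactly to the finite group. *)
pose F := x0 :: T.
have netF x : exists2 f, f \in F & rho (x - f) < eta / 3%:R.
  by have [f fT hf] := netT x; exists f => //; rewrite inE fT orbT.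
pose P : finZmodType := 'rV['I_n.+2]_(size F).
pose rh : P -> R := rho \o @comb G n F.
have rhP : group_seminorm rh by exact: sn_comb.
pose e0 : P := unit_vec n (ord0 : 'I_(size F)).
have rhe0 : rh e0 = a by rewrite /rh /= comb_unit.
pose B := [pred v : P | rh v < r].
have cardP0 : 0 < #|P|%:R :> R by rewrite ltr0n; apply/card_gt0P; exists 0.
have cardB : #|P|%:R / (size S)%:R <= #|B|%:R :> R.
  rewrite ler_pdivrMr// mulrC -natrM ler_nat.
  exact: comb_ball_card.
pose f (v : P) : R := (B v)%:R - (B (v - e0))%:R.
have expP (v : P) : v *+ n.+2 = 0.
  by apply/rowP => i; rewrite mulmxnE mxE Zp_mulrn; apply: val_inj; rewrite /= modnMl.
have sB : \sum_v (B v)%:R = #|B|%:R :> R by rewrite -natr_sum -big_mkcond sum1_card.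
have sB' : \sum_v (B (v - e0))%:R = #|B|%:R :> R.
  by rewrite -sB [RHS](reindex_inj (subIr e0)).
suff : c <= n.+2%:R * eta by rewrite leNgt etac.
apply: (conv_growth_le_exponent rhP (isT : (0 < n.+2)%N) expP
  (comb_gen rhoP expN ch eta0 netF) c0 eta0 (f := f)).
- by rewrite /f sumrB sB sB' subrr.
- rewrite /dotp (bigD1 0)//= ltr_pwDl ?sumr_ge0// => [|i _]; last by rewrite -expr2 sqr_ge0.
  have B0 : B 0 by rewrite /B /= (sn0 rhP).
  have B1 : B (0 - e0) = false.
    by rewrite /B /= sub0r (snN rhP) rhe0 ltNge /r ler_pdivrMr// ler_peMr ?ler1n// ltW.
  by rewrite /f B0 B1 subr0 mulr1.
have ub : dotp f f <= #|B|%:R *+ 2.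
  rewrite mulr2n -{1}sB -sB' -big_split; apply: ler_sum => v _ /=.
  by rewrite /f /=; case: (rh v < r); case: (rh (v - e0) < r) => /=; lra.
have conv_low x : B x -> conv rh f x <= - (a / (size S)%:R / 2%:R).
  move=> Bx; rewrite /conv.
  have -> : \sum_y rh (x - y) * f y =
      \sum_y (B y)%:R * (rh (x - y) - rh (x - y - e0)).
    under eq_bigr do rewrite mulrBr; rewrite sumrB.
    rewrite [X in _ - X](reindex_inj (addIr e0)) -sumrB.
    apply: eq_bigr => y _; rewrite addrK opprD addrA.
    by rewrite mulrBr ![_ * (B y)%:R]mulrC.
  have le1 : \sum_y (B y)%:R * (rh (x - y) - rh (x - y - e0)) <=
      \sum_y (B y)%:R * (- (a / 2)).
    apply: ler_sum => y _; have [By|_] := boolP (B y); last by rewrite !mul0r.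
    rewrite !mul1r; have h1 := snB rhP x y.
    have h2 := snBC rhP (x - y) e0.
    have h3 := sn_tri rhP (x - y) e0 0.
    rewrite !subr0 rhe0 in h3.
    have h4 : rh x < r by []. have h5 : rh y < r by [].
    by rewrite /r in h4 h5; lra.
  rewrite -mulr_suml sB in le1.
  have p0 : 0 <= #|P|%:R^-1 :> R by rewrite invr_ge0 ltW.
  apply: le_trans (ler_wpM2l p0 le1) _.
  have hB : (size S)%:R^-1 <= #|P|%:R^-1 * #|B|%:R :> R.
    by rewrite -(ler_pM2l cardP0) mulrA divff ?gt_eqF// mul1r.
  have a2 : 0 <= a / 2 by rewrite divr_ge0// ltW.
  by have := ler_wpM2r a2 hB; rewrite mulrA; lra.
pose d := a / (size S)%:R / 2%:R.
have d0 : 0 < d by rewrite !divr_gt0.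
have lb : #|B|%:R * d ^+ 2 <= dotp (conv rh f) (conv rh f).
  rewrite -sB mulr_suml; apply: ler_sum => x _.
  have [/conv_low hx|_] := boolP (B x); last by rewrite mul0r -expr2 sqr_ge0.
  rewrite mul1r -expr2 -[leRHS]sqrrN lerXn2r// ?nnegrE; rewrite -/d in hx; lra.
apply: le_trans lb; apply: le_trans (ler_wpM2l (sqr_ge0 c) ub) _.
have -> : c = d / 2 by rewrite /c /d; field; rewrite gt_eqF.
by rewrite -mulr_natl; have := ler0n R #|B|; have := sqr_ge0 d; nra.
Qed.

End TorsionSeminorm.

(** * Multiples of a small ball become dense *)

Section Gauge.
Variables (R : realType) (G : zmodType) (near : R -> G -> Prop).
Hypothesis near_ge0 : forall r x, near r x -> 0 <= r.
Hypothesis near_ex : forall x, exists r, near r x.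
Hypothesis near0 : forall r : R, 0 < r -> near r 0.
Hypothesis nearN : forall r x, near r x -> near r (- x).
Hypothesis nearD : forall r s x y, near r x -> near s y -> near (r + s) (x + y).

Definition gauge (x : G) : R := inf [set r | near r x].

Let gauge_has_inf x : has_inf [set r | near r x].
Proof.
by split; [exact: near_ex | exists 0 => r /near_ge0].
Qed.

Lemma gauge_le r x : near r x -> gauge x <= r.
Proof. by move=> h; apply: ge_inf => //; case: (gauge_has_inf x). Qed.

Lemma gauge_lt r x : gauge x < r -> exists2 s, s < r & near s x.
Proof. by move=> /(inf_lt (near_ex x))[s]; exists s. Qed.

Lemma gauge_seminorm : group_seminorm gauge.
Proof.
have g0 x : 0 <= gauge x.
  by apply: lb_le_inf; [exact: near_ex | move=> r /near_ge0].
split.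
- apply/eqP; rewrite eq_le g0 andbT; apply/ler_addgt0Pr => e e0; rewrite add0r.
  exact/gauge_le/near0.
- by move=> x; congr inf; apply/seteqP; split=> r /= /nearN; rewrite ?opprK.
- move=> x y; apply/ler_addgt0Pr => e e0.
  have e20 : 0 < e / 2 by rewrite divr_gt0.
  have [r rx nrx] : exists2 r, r < gauge x + e / 2 & near r x.
    by apply: gauge_lt; rewrite ltrDl.
  have [s sy nsy] : exists2 s, s < gauge y + e / 2 & near s y.
    by apply: gauge_lt; rewrite ltrDl.
  by have := gauge_le (nearD nrx nsy); lra.
Qed.

End Gauge.

Lemma totally_bounded_sn_le (R : realType) (G : zmodType) (phi rho : G -> R) :
  (forall x, phi x <= rho x) -> totally_bounded_sn rho -> totally_bounded_sn phi.
Proof.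
move=> le tb e /tb[s hs]; exists s => x; have [f fs hf] := hs x.
by exists f => //; apply: le_lt_trans hf.
Qed.

Lemma chainable_le (R : realType) (G : zmodType) (phi rho : G -> R) :
  (forall x, phi x <= rho x) -> chainable rho -> chainable phi.
Proof.
move=> le ch e e0 x; have [s [/allP hs ->]] := ch e e0 x; exists s; split=> //.
by apply/allP => t ts; apply: le_lt_trans (hs t ts).
Qed.

Lemma ultra_pigeonhole (T : Type) (I : eqType) (U : set_system T) (S : seq I)
    (A : set T) (Q : I -> set T) :
  UltraFilter U -> U A -> (forall n, A n -> exists2 f, f \in S & Q f n) ->
  exists2 f, f \in S & U (Q f).
Proof.
move=> UU; elim: S A => [|f S IH] A UA hA.
  by have [n /hA[]] := filter_ex UA.
have [Uf|nUf] := in_ultra_setVsetC (Q f) UU; first by exists f; rewrite ?mem_head.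
have [n [An nQ]|g gS Ug] := IH (A `&` ~` Q f) (filterI UA nUf).
  have [g] := hA n An; rewrite inE => /orP[/eqP-> //|gS Qg]; by exists g.
by exists g => //; rewrite inE gS orbT.
Qed.

(** Finitely many alternatives, one of which holds at each scale: one of them holds
    at all scales. *)
Lemma eps_pigeonhole (R : realType) (I : eqType) (S : seq I) (Q : I -> R -> Prop) :
  (forall f e e', Q f e -> e <= e' -> Q f e') ->
  (forall e, 0 < e -> exists2 f, f \in S & Q f e) ->
  exists2 f, f \in S & forall e, 0 < e -> Q f e.
Proof.
move=> mono; elim: S => [|f S IH] hQ; first by have [] := hQ 1 ltr01.
have [hf|/existsNP[e1 /not_implyP[e10 nQ]]] := pselect (forall e, 0 < e -> Q f e).
  by exists f; rewrite ?mem_head.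
have [e e0|g gS hg] := IH; last by exists g => //; rewrite inE gS orbT.
have [|g] := hQ (Num.min e e1); first by rewrite lt_min e0.
rewrite inE => /orP[/eqP->|gS] hg.
  by exfalso; apply: nQ; apply: mono hg _; rewrite ge_min lexx orbT.
by exists g => //; apply: mono hg _; rewrite ge_min lexx.
Qed.

Section Mixing.
Variables (R : realType) (G : zmodType) (rho : G -> R).
Hypothesis rhoP : group_seminorm rho.
Hypothesis tb : totally_bounded_sn rho.
Hypothesis ch : chainable rho.

Section UltraLimit.
Variable U : set_system nat.
Hypothesis UU : UltraFilter U.
Hypothesis U_tail : forall m, U [set n | (m <= n)%N].

(** [x] is within [r] of limits, along [U], of [n]-th multiples of elements tending
    to zero.  The gauge of this relation is the distance to the closed subgroup of
    such limits; it is defined without assuming that the limits exist. *)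
Definition ultra_near (r : R) (x : G) := forall e, 0 < e ->
  U [set n | exists2 w, rho w < e & rho (x - w *+ n) < r].

Lemma ultra_near_lt r x : rho x < r -> ultra_near r x.
Proof.
move=> xr e e0; apply: filterS (filterT : U setT) => n _; exists 0.
  by rewrite (sn0 rhoP).
by rewrite mul0rn subr0.
Qed.

Lemma ultra_near_gt0 r x : ultra_near r x -> 0 < r.
Proof.
move=> /(_ _ ltr01)/filter_ex[n [w _ h]].
by apply: le_lt_trans h; exact: sn_ge0.
Qed.

Lemma ultra_nearN r x : ultra_near r x -> ultra_near r (- x).
Proof.
move=> h e /h; apply: filterS => n [w w1 w2]; exists (- w).
  by rewrite (snN rhoP).
by rewrite mulNrn -opprD (snN rhoP).
Qed.

Lemma ultra_nearD r s x y : ultra_near r x -> ultra_near s y ->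
  ultra_near (r + s) (x + y).
Proof.
move=> hx hy e e0; have e20 : 0 < e / 2 by rewrite divr_gt0.
apply: filterS (filterI (hx _ e20) (hy _ e20)) => n [[w w1 w2] [v v1 v2]].
exists (w + v); first by have := snD rhoP w v; lra.
rewrite mulrnDl opprD addrACA.
by have := snD rhoP (x - w *+ n) (y - v *+ n); lra.
Qed.

Let phi := gauge ultra_near.

Let near_ge0 r x (h : ultra_near r x) : 0 <= r := ltW (ultra_near_gt0 h).

Let near_ex x : exists r, ultra_near r x.
Proof. by exists (rho x + 1); apply: ultra_near_lt; rewrite ltrDl. Qed.

Let near0 (r : R) : 0 < r -> ultra_near r 0.
Proof. by move=> r0; apply: ultra_near_lt; rewrite (sn0 rhoP). Qed.

Let phiP : group_seminorm phi.
Proof. exact: (gauge_seminorm near_ge0 near_ex near0 ultra_nearN ultra_nearD). Qed.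

Let phi_le r x : ultra_near r x -> phi x <= r.
Proof. exact: (gauge_le near_ge0 near_ex). Qed.

Let phi_rho x : phi x <= rho x.
Proof.
apply/ler_addgt0Pr => e e0; apply: phi_le; apply: ultra_near_lt.
by rewrite ltrDl.
Qed.

(** Otherwise multiples of arbitrarily small elements stay, for [U]-almost all [n],
    in the region [d < phi] and near one fixed point [f] of a net; but then
    [f] is almost a limit of such multiples, so that [phi f] is small. *)
Lemma ultra_equicontinuous (d : R) : 0 < d ->
  exists2 e, 0 < e & U [set n | forall w, rho w < e -> phi (w *+ n) <= d].
Proof.
move=> d0; apply: contrapT => hno.
have [S netS] := tb (divr_gt0 d0 (@ltr0n R 4)).
pose Q f e := U [set n | exists w, [/\ rho w < e, d < phi (w *+ n) &
                                     rho (w *+ n - f) < d / 4%:R]].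
have [f fS hf] : exists2 f, f \in S & forall e, 0 < e -> Q f e.
  apply: eps_pigeonhole => [f e e' h ee'|e e0].
    apply: filterS h => n [w [w1 w2 w3]]; exists w; split=> //.
    exact: lt_le_trans ee'.
  have hU : U (~` [set n | forall w, rho w < e -> phi (w *+ n) <= d]).
    have [h|//] := in_ultra_setVsetC
      [set n | forall w, rho w < e -> phi (w *+ n) <= d] UU.
    by exfalso; apply: hno; exists e.
  apply: (ultra_pigeonhole UU hU) => n /existsNP[w /not_implyP[w1 /negP]].
  rewrite -ltNge => w2; have [f fS w3] := netS (w *+ n).
  by exists f => //; exists w.
have phif : phi f <= d / 4%:R.
  apply: phi_le => e e0; apply: filterS (hf e e0) => n [w [w1 _ w3]].
  by exists w => //; rewrite (snBC rhoP).
have [n [w [w1 w2 w3]]] := filter_ex (hf 1 ltr01).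
have h := snD phiP (w *+ n - f) f; rewrite subrK in h.
by have := phi_rho (w *+ n - f); lra.
Qed.

Lemma ultra_cauchy (d : R) x : 0 < d -> exists y, U [set n | rho (x *+ n - y) < d].
Proof.
move=> d0; have [S netS] := tb d0.
have [|y _ hy] := @ultra_pigeonhole _ _ U S setT
  (fun y => [set n | rho (x *+ n - y) < d]) UU filterT.
  by move=> n _; have [f fS hf] := netS (x *+ n); exists f.
by exists y.
Qed.

Lemma ultra_cauchy_seq (d : R) (s : seq G) : 0 < d ->
  exists2 A, U A & forall n m x, A n -> A m -> x \in s -> rho (x *+ n - x *+ m) < d.
Proof.
move=> d0; elim: s => [|x s [A UA IH]]; first by exists setT => //; exact: filterT.
have [y hy] := ultra_cauchy x (divr_gt0 d0 (@ltr0n R 2)).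
exists (A `&` [set n | rho (x *+ n - y) < d / 2]); first exact: filterI.
move=> n m z [An hn] [Am hm]; rewrite inE => /orP[/eqP->|zs]; last exact: IH.
have hn' : rho (x *+ n - y) < d / 2 by [].
have hm' : rho (x *+ m - y) < d / 2 by [].
by have := sn_tri rhoP y (x *+ n) (x *+ m); rewrite (snBC rhoP y); lra.
Qed.

(** Along [U], multiplication by [n] converges on a finite net, and it is
    equicontinuous for [phi].  Hence two members [n < l] of a set of [U] act in
    nearly the same way on the whole group, and [N = l - n] is nearly zero. *)
Lemma ultra_small_multiple (d : R) : 0 < d ->
  exists2 N, (0 < N)%N & forall x, phi (x *+ N) <= d.
Proof.
move=> d0; have d40 : 0 < d / 4%:R by rewrite divr_gt0.
have [e e0 hE] := ultra_equicontinuous d40.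
have [S netS] := tb e0.
have [A UA hA] := ultra_cauchy_seq S d40.
have UB : U (A `&` [set n | forall w, rho w < e -> phi (w *+ n) <= d / 4%:R]).
  exact: filterI.
have [n [An hn]] := filter_ex UB.
have [l [[Al hl] /= nl]] := filter_ex (filterI UB (U_tail n.+1)).
exists (l - n)%N; first by rewrite subn_gt0.
move=> x; rewrite mulrnBr; last exact: ltnW.
have [f fS hf] := netS x.
have -> : x *+ l - x *+ n =
    (f *+ l - f *+ n) + ((x - f) *+ l - (x - f) *+ n).
  by rewrite !mulrnBl opprB addrACA addKr [_ + (_ - _)]addrC subrK.
have h1 := snD phiP (f *+ l - f *+ n) ((x - f) *+ l - (x - f) *+ n).
have h2 := snB phiP ((x - f) *+ l) ((x - f) *+ n).
have h3 := phi_rho (f *+ l - f *+ n).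
have h4 := hA l n f Al An fS.
have h5 := hl _ hf.
have h6 := hn _ hf.
by lra.
Qed.

(** Modulo the subgroup of [N]-th multiples, [phi] becomes a seminorm to which
    [torsion_seminorm_trivial] applies.  So every [x] is [phi]-close to an [N]-th
    multiple, and [N]-th multiples are [phi]-small. *)
Lemma ultra_gauge0 x : phi x = 0.
Proof.
apply/eqP; rewrite eq_le (sn_ge0 phiP) andbT.
apply/ler_addgt0Pr => d d0; rewrite add0r.
have d20 : 0 < d / 2 by rewrite divr_gt0.
have [N N0 hN] := ultra_small_multiple d20.
pose near (r : R) (z : G) := exists y, phi (z - y *+ N) < r.
have n_ge0 r z : near r z -> 0 <= r.
  by move=> [y /ltW]; apply: le_trans; exact: sn_ge0 phiP _.
have n_lt r z : phi z < r -> near r z by move=> h; exists 0; rewrite mul0rn subr0.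
have n_ex z : exists r, near r z.
  by exists (phi z + 1); apply: n_lt; rewrite ltrDl.
have n_0 r : 0 < r -> near r 0 by move=> r0; apply: n_lt; rewrite (sn0 phiP).
have n_N r z : near r z -> near r (- z).
  by move=> [y hy]; exists (- y); rewrite mulNrn -opprD (snN phiP).
have n_D r s z z' : near r z -> near s z' -> near (r + s) (z + z').
  move=> [y hy] [y' hy']; exists (y + y'); rewrite mulrnDl opprD addrACA.
  by have := snD phiP (z - y *+ N) (z' - y' *+ N); lra.
have psiP := gauge_seminorm n_ge0 n_ex n_0 n_N n_D.
have psi_phi z : gauge near z <= phi z.
  apply/ler_addgt0Pr => e e0; apply: gauge_le n_ge0 n_ex _ _ _.
  by apply: n_lt; rewrite ltrDl.
have psi_rho z : gauge near z <= rho z := le_trans (psi_phi z) (phi_rho z).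
have psiN z : gauge near (z *+ N) = 0.
  apply/eqP; rewrite eq_le (sn_ge0 psiP) andbT; apply/ler_addgt0Pr => e e0.
  rewrite add0r; apply: gauge_le n_ge0 n_ex _ _ _.
  by exists z; rewrite subrr (sn0 phiP).
have psi0 := torsion_seminorm_trivial psiP (totally_bounded_sn_le psi_rho tb)
  (chainable_le psi_rho ch) N0 psiN x.
have [s sd [y hy]] : exists2 s, s < d / 2 & near s x.
  by apply: (gauge_lt n_ex); rewrite psi0.
have := snD phiP (x - y *+ N) (y *+ N); rewrite subrK.
by have := hN y; lra.
Qed.

Lemma ultra_near_all (r : R) x : 0 < r -> ultra_near r x.
Proof.
move=> r0; have : phi x < r by rewrite ultra_gauge0.
move=> /(gauge_lt near_ex)[s sr hs] e /hs.
by apply: filterS => n [w w1 w2]; exists w => //; apply: lt_trans sr.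
Qed.

End UltraLimit.

(** If the statement failed for infinitely many [n], an ultrafilter concentrated on
    them would contradict [ultra_near_all]: the point [u - lim (v *+ n)] is near a
    multiple [w *+ n] with [w] small, and [x = v + w] works. *)
Theorem multiples_mixing u v (e : R) : 0 < e -> exists m, forall n, (m <= n)%N ->
  exists2 x, rho (x - v) < e & rho (x *+ n - u) < e.
Proof.
move=> e0; apply: contrapT => hno.
pose A := [set n | ~ exists2 x, rho (x - v) < e & rho (x *+ n - u) < e].
have hA m : exists2 n, (m <= n)%N & A n.
  apply: contrapT => h; apply: hno; exists m => n mn.
  by apply: contrapT => An; apply: h; exists n.
pose F : set_system nat := [set B | exists m, forall n, (m <= n)%N -> A n -> B n].
have FF : ProperFilter F.
  split; first by move=> [m hm]; have [n mn An] := hA m; exact: (hm n).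
  split; first by exists 0%N.
    move=> B C [m hm] [p hp]; exists (maxn m p) => n; rewrite geq_max => /andP[mn pn] An.
    by split; [exact: hm | exact: hp].
  by move=> B C BC [m hm]; exists m => n mn An; apply: BC; exact: hm.
have [U [UU FU]] := ultraFilterLemma FF.
have U_tail m : U [set n | (m <= n)%N] by apply: FU; exists m.
have UA : U A by apply: FU; exists 0%N.
have e20 : 0 < e / 2 by rewrite divr_gt0.
have [y hy] := ultra_cauchy UU v e20.
have hw := ultra_near_all UU U_tail (u - y) e20 e0.
have [n [[/= h1 [w h2 h3]] An]] := filter_ex (filterI (filterI hy hw) UA).
apply: An; exists (v + w); first by rewrite addrC addKr.
rewrite mulrnDl.
have -> : v *+ n + w *+ n - u = (v *+ n - y) - (u - y - w *+ n).
  by rewrite !opprB addrACA addKr.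
by have := snB rhoP (v *+ n - y) (u - y - w *+ n); lra.
Qed.

End Mixing.

(** * Spaces with an explicit distance function *)

Lemma compact_finite_cover (T : topologicalType) (P : T -> set T) :
  compact [set: T] -> (forall x, nbhs x (P x)) ->
  exists s : seq T, forall y, exists2 x, x \in s & P x y.
Proof.
move=> /compact_near_coveringP cT nP.
pose F : set_system (seq T) :=
  [set B | exists s0 : seq T, forall s : seq T, {subset s0 <= s} -> B s].
have FF : Filter F.
  split; first by exists [::].
    move=> A B [s hs] [t ht]; exists (s ++ t) => u hu.
    by split; [apply: hs | apply: ht] => x xs; apply: hu; rewrite mem_cat xs ?orbT.
  by move=> A B AB [s hs]; exists s => t /hs/AB.
have := cT _ F (fun s y => exists2 x, x \in s & P x y) FF.
case=> [x _|s0 hs0]; last first.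
  by exists s0 => y; exact: (hs0 s0 (fun _ h => h) y I).
exists (P x, [set s : seq T | x \in s]) => /=.
  by split; [exact: nP | exists [:: x] => s; apply; rewrite mem_head].
by move=> [y s] /= [Py xs]; exists x.
Qed.

Lemma seq_min_pos (R : realType) (I : eqType) (s : seq I) (d : I -> R) :
  (forall x, x \in s -> 0 < d x) ->
  exists2 e : R, 0 < e & forall x, x \in s -> e <= d x.
Proof.
elim: s => [_|x s IH hd]; first by exists 1.
have [y ys|e e0 he] := IH; first by apply: hd; rewrite inE ys orbT.
exists (Num.min e (d x)); first by rewrite lt_min e0 hd ?mem_head.
move=> y; rewrite inE => /orP[/eqP->|/he ey]; rewrite ge_min ?lexx ?orbT//.
by rewrite ey.
Qed.

(** A distance is handled as a plain function generating the topology, because the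
    same space carries several of them: an invariant one, a product one, one that is
    summed over orbits. *)
Definition metrizes (R : realType) (T : topologicalType) (D : T -> T -> R) :=
  [/\ (forall x, D x x = 0), (forall x y, D x y = 0 -> x = y),
      (forall x y, D x y = D y x), (forall y x z, D x z <= D x y + D y z) &
      forall x A, nbhs x A <-> exists2 e : R, 0 < e & forall y, D x y < e -> A y].

Section MetrizesTheory.
Variables (R : realType) (T : topologicalType) (D : T -> T -> R).
Hypothesis DP : metrizes D.

Lemma mz_xx x : D x x = 0. Proof. by case: DP. Qed.
Lemma mz_eq x y : D x y = 0 -> x = y. Proof. by case: DP => _ h _ _ _; exact: h. Qed.
Lemma mz_sym x y : D x y = D y x. Proof. by case: DP. Qed.
Lemma mz_tri y x z : D x z <= D x y + D y z. Proof. by case: DP. Qed.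

Lemma mz_nbhs x A : nbhs x A <-> exists2 e : R, 0 < e & forall y, D x y < e -> A y.
Proof. by case: DP. Qed.

Lemma mz_ge0 x y : 0 <= D x y.
Proof. by have := mz_tri y x x; rewrite mz_xx (mz_sym y x); lra. Qed.

Lemma mz_ball x (e : R) : 0 < e -> nbhs x [set y | D x y < e].
Proof. by move=> e0; apply/mz_nbhs; exists e. Qed.

Lemma mz_eq_lt x y : (forall e : R, 0 < e -> D x y < e) -> x = y.
Proof.
move=> h; apply: mz_eq; apply/eqP; rewrite eq_le mz_ge0 andbT.
by rewrite leNgt; apply/negP => /h; rewrite ltxx.
Qed.

End MetrizesTheory.

Lemma mdist_metrizes (R : realType) (Z : metricType R) : metrizes (@mdist R Z).
Proof.
split; [exact: mdistxx | exact: mdist_positivity | exact: metric_sym |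
        move=> y x z; exact: metric_triangle |].
move=> x A; rewrite nbhs_ballP; split=> -[e /= e0 h]; exists e => // y.
  by move=> xy; apply: h; rewrite ballEmdist.
by rewrite ballEmdist => /h.
Qed.

Section MetrizesCompact.
Variables (R : realType) (T : topologicalType) (D : T -> T -> R).
Hypothesis DP : metrizes D.

Lemma mz_metrizable : metrizable R T.
Proof.
pose m := @isMetric.Build R T D (mz_xx DP) (mz_eq DP) (mz_sym DP) (mz_tri DP).
pose M : metricType R := HB.pack (T : Type) (Choice.class T) m.
have MP := mdist_metrizes M.
have nbhsM (x : M) (A : set M) : @nbhs _ M x A <-> @nbhs _ T x A.
  by split=> [/(mz_nbhs MP)|] h; [apply/(mz_nbhs DP) | apply/(mz_nbhs MP)/(mz_nbhs DP)].
exists M, (fun x : T => x : M), (fun x : M => x : T); split=> //.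
  by move=> x A /nbhsM.
by move=> x A /nbhsM.
Qed.

Lemma mz_totally_bounded (e : R) : compact [set: T] -> 0 < e ->
  exists s : seq T, forall y, exists2 x, x \in s & D x y < e.
Proof.
move=> cT e0; apply: (@compact_finite_cover _ (fun x => [set y | D x y < e])) => // x.
exact: mz_ball DP _ _ e0.
Qed.

Lemma mz_complete (u : nat -> T) : compact [set: T] ->
  (forall e : R, 0 < e -> exists N, forall n m, (N <= n)%N -> (N <= m)%N -> D (u n) (u m) < e) ->
  exists l, forall e : R, 0 < e -> exists N, forall n, (N <= n)%N -> D (u n) l < e.
Proof.
move=> cT cu.
have [l [_ hl]] := cT (u @ \oo) _ (filterT : (u @ \oo) setT).
exists l => e e0; have e20 : 0 < e / 2 by rewrite divr_gt0.
have [N hN] := cu _ e20; exists N => n Nn.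
have tail : (u @ \oo) [set y | exists2 m, (N <= m)%N & y = u m].
  by exists N => // m Nm; exists m.
have [_ [[m Nm ->] hm]] := hl _ _ tail (mz_ball DP l e20).
have hm' : D l (u m) < e / 2 by [].
by have := mz_tri DP (u m) (u n) l; have := hN n m Nn Nm; rewrite (mz_sym DP (u m)); lra.
Qed.

End MetrizesCompact.

Lemma real_metrizes (R : realType) : metrizes (fun x y : R => `|x - y|).
Proof.
split=> [x|x y /eqP|x y|y x z|x A]; first by rewrite subrr normr0.
- by rewrite normr_eq0 subr_eq0 => /eqP.
- by rewrite distrC.
- exact: ler_distD.
- by rewrite nbhs_ballP; split=> -[e e0 h]; exists e.
Qed.

Lemma metrizable_metrizes (R : realType) (T : topologicalType) :
  metrizable R T -> exists D : T -> T -> R, metrizes D.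
Proof.
move=> [M [f [g [cf cg fK gK]]]]; exists (fun x y => mdist (f x) (f y)).
have MP := mdist_metrizes M.
split=> [x|x y /(mz_eq MP)/(can_inj fK)//|x y|y x z|x A]; first exact: mz_xx.
- exact: mz_sym.
- exact: mz_tri.
split.
  rewrite -{1}(fK x) => /cg/(mz_nbhs MP)[e e0 h]; exists e => // y /h.
  by rewrite /= fK.
move=> [e e0 h]; have := cf x _ (mz_ball MP (f x) e0).
by apply: (@filterS _ (nbhs x)) => y; exact: h.
Qed.

Definition prod_dist (R : realType) (S T : Type) (D : S -> S -> R) (E : T -> T -> R)
  (x y : S * T) : R := Num.max (D x.1 y.1) (E x.2 y.2).

Lemma prod_metrizes (R : realType) (S T : topologicalType)
    (D : S -> S -> R) (E : T -> T -> R) :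
  metrizes D -> metrizes E -> metrizes (prod_dist D E).
Proof.
move=> DP EP; split.
- by move=> x; rewrite /prod_dist (mz_xx DP) (mz_xx EP) maxxx.
- move=> [a b] [c d] /eqP; rewrite /prod_dist /= eq_le ge_max => /andP[/andP[h1 h2] _].
  congr (_, _); [apply: (mz_eq DP) | apply: (mz_eq EP)]; apply/eqP; rewrite eq_le ?h1 ?h2.
    exact: mz_ge0 DP _ _.
  exact: mz_ge0 EP _ _.
- by move=> x y; rewrite /prod_dist (mz_sym DP) (mz_sym EP).
- move=> y x z; rewrite /prod_dist ge_max; apply/andP; split.
    apply: le_trans (mz_tri DP y.1 _ _) _.
    by apply: lerD; rewrite le_max lexx.
  apply: le_trans (mz_tri EP y.2 _ _) _.
  by apply: lerD; rewrite le_max lexx orbT.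
- move=> [a b] A; split.
    move=> [[U V] /= [/(mz_nbhs DP)[e e0 hU] /(mz_nbhs EP)[d d0 hV]] UVA].
    exists (Num.min e d); first by rewrite lt_min e0.
    move=> [x y]; rewrite /prod_dist /= gt_max !lt_min => /andP[/andP[h1 h2] /andP[h3 h4]].
    by apply: UVA; split; [exact: hU | exact: hV].
  move=> [e e0 h]; exists ([set x | D a x < e], [set y | E b y < e]).
    by split; [exact: mz_ball DP _ _ e0 | exact: mz_ball EP _ _ e0].
  by move=> [x y] /= [h1 h2]; apply: h; rewrite /prod_dist gt_max h1.
Qed.

Lemma prod_dist_lt (R : realType) (S T : Type) (D : S -> S -> R) (E : T -> T -> R)
  (x y : S * T) (e : R) :
  prod_dist D E x y < e <-> D x.1 y.1 < e /\ E x.2 y.2 < e.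
Proof. by rewrite /prod_dist gt_max; split=> /andP. Qed.

Section MetrizesMaps.
Variables (R : realType) (S T : topologicalType) (D : S -> S -> R) (E : T -> T -> R).
Hypotheses (DP : metrizes D) (EP : metrizes E).

Lemma continuous_atP (f : S -> T) x : {for x, continuous f} <->
  forall e : R, 0 < e -> exists2 d : R, 0 < d & forall y, D x y < d -> E (f x) (f y) < e.
Proof.
split=> [cf e e0|h A /(mz_nbhs EP)[e e0 hA]].
  by have /(mz_nbhs DP) := cf _ (mz_ball EP (f x) e0).
have [d d0 hd] := h e e0; apply/(mz_nbhs DP); exists d => // y /hd; exact: hA.
Qed.

Lemma continuousP_eps (f : S -> T) : continuous f <->
  forall x (e : R), 0 < e -> exists2 d : R, 0 < d & forall y, D x y < d -> E (f x) (f y) < e.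
Proof. by split=> h x; apply/continuous_atP; exact: h. Qed.

Lemma compact_unif_continuous (f : S -> T) : compact [set: S] -> continuous f ->
  forall e : R, 0 < e -> exists2 d : R, 0 < d & forall x y, D x y < d -> E (f x) (f y) < e.
Proof.
move=> cS /continuousP_eps cf e e0.
have e20 : 0 < e / 2 by rewrite divr_gt0.
have /choice[d hd] : forall x, exists d : R, 0 < d /\
    forall y, D x y < d -> E (f x) (f y) < e / 2.
  by move=> x; have [d d0 h] := cf x _ e20; exists d.
have d20 x : 0 < d x / 2 by rewrite divr_gt0//; case: (hd x).
have [s hs] := @compact_finite_cover S (fun x => [set y | D x y < d x / 2]) cS
  (fun x => mz_ball DP x (d20 x)).
have [r r0 hr] := @seq_min_pos R S s (fun x => d x / 2) (fun x _ => d20 x).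
exists r => // x y xy; have [c cs cx] := hs x; have rc := hr c cs.
have [d0 hc] := hd c.
have cx' : D c x < d c / 2 by [].
have h1 : E (f c) (f x) < e / 2 by apply: hc; lra.
have h2 : E (f c) (f y) < e / 2.
  by apply: hc; have := mz_tri DP x c y; lra.
by have := mz_tri EP (f c) (f x) (f y); rewrite (mz_sym EP (f x) (f c)); lra.
Qed.

End MetrizesMaps.

Lemma compact_setT_prod (S T : topologicalType) :
  compact [set: S] -> compact [set: T] -> compact [set: S * T].
Proof. by move=> cS cT; rewrite -setXTT; exact: compact_setX. Qed.

Lemma pair_continuous (A B C : topologicalType) (f : A -> B) (g : A -> C) x :
  {for x, continuous f} -> {for x, continuous g} ->
  {for x, continuous (fun y => (f y, g y))}.
Proof. by move=> cf cg; apply: (cvg_pair cf cg). Qed.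

(** * The seminorm of a compact connected abelian group *)

Section GroupNorm.
Variables (R : realType) (G : topologicalZmodType).
Hypotheses (G_compact : compact [set: G]) (G_metrizable : metrizable R G).

(** Averaging over translations would need a measure; a supremum does as well.  The
    seminorm [sup_g D (x + g) g] is invariant, dominates [D], and is continuous at
    zero because addition is uniformly continuous. *)
Lemma compact_group_norm : exists rho : G -> R,
  group_seminorm rho /\ metrizes (fun x y => rho (x - y)).
Proof.
have [D DP] := metrizable_metrizes G_metrizable.
have DDP := prod_metrizes DP DP.
have addc : continuous (fun x : G * G => x.1 + x.2) by exact: add_continuous.
have addu := compact_unif_continuous DDP DP
  (compact_setT_prod G_compact G_compact) addc.
have [B hB] : exists B : R, forall x y, D x y <= B.
  have [s hs] := mz_totally_bounded DP G_compact (ltr01 : 0 < 1 :> R).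
  pose b := \sum_(p <- s) \sum_(q <- s) D p q.
  exists (b + 2) => x y; have [p ps hp] := hs x; have [q qs hq] := hs y.
  have pq : D p q <= b.
    rewrite /b (big_rem p)//= (big_rem q)//= -addrA lerDl addr_ge0//.
      by apply: sumr_ge0 => ? _; exact: mz_ge0 DP _ _.
    by apply: sumr_ge0 => ? _; apply: sumr_ge0 => ? _; exact: mz_ge0 DP _ _.
  have := mz_tri DP p x y; have := mz_tri DP q p y.
  by rewrite (mz_sym DP x p); lra.
pose rho x := sup [set D (x + g) g | g in [set: G]].
have hs x : has_sup [set D (x + g) g | g in [set: G]].
  by split; [exists (D (x + 0) 0), 0 | exists B => _ [g _ <-]].
have le_rho x g : D (x + g) g <= rho x.
  by apply: ub_le_sup; [case: (hs x) | exists g].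
have rho_le x (r : R) : (forall g, D (x + g) g <= r) -> rho x <= r.
  by move=> h; apply: ge_sup; [case: (hs x) | move=> _ [g _ <-]].
have rhoP : group_seminorm rho.
  have ge0 x : 0 <= rho x by apply: le_trans (le_rho x 0); exact: mz_ge0 DP _ _.
  have N x : rho (- x) <= rho x.
    apply: rho_le => g; rewrite (mz_sym DP).
    by have := le_rho x (- x + g); rewrite addrA subrr add0r.
  split.
  - apply/eqP; rewrite eq_le ge0 andbT; apply: rho_le => g.
    by rewrite add0r (mz_xx DP).
  - by move=> x; apply/eqP; rewrite eq_le N -{1}[x]opprK N.
  - move=> x y; apply: rho_le => g.
    apply: le_trans (mz_tri DP (y + g) _ _) _.
    by rewrite -addrA lerD.
exists rho; split=> //; split.
- by move=> x; rewrite subrr (sn0 rhoP).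
- move=> x y xy; apply: (mz_eq DP); apply/eqP; rewrite eq_le (mz_ge0 DP) andbT.
  by have := le_rho (x - y) y; rewrite xy subrK.
- by move=> x y; rewrite (snBC rhoP).
- by move=> y x z; exact: sn_tri.
move=> x A; split.
  move=> /(mz_nbhs DP)[e e0 h]; exists e => // y xy; apply: h.
  by apply: le_lt_trans xy; have := le_rho (x - y) y; rewrite subrK.
move=> [e e0 h].
have e20 : 0 < e / 2 by rewrite divr_gt0.
have [d d0 hd] := addu _ e20.
have : nbhs (x - x) [set t | D 0 t < d].
  by rewrite subrr; exact: mz_ball.
have subc : {for x, continuous (fun y => x - y)}.
  apply: (@continuous_comp _ _ _ (fun y : G => (x, - y)) (fun p : G * G => p.1 + p.2));
    last exact: addc.
  by apply: cvg_pair; [exact: cvg_cst | exact: opp_continuous].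
move=> /subc; apply: (@filterS _ (nbhs x)) => y /= xy; apply: h.
apply: (@le_lt_trans _ _ (e / 2)); last by rewrite ltr_pdivrMr// ltr_pMr// ltr1n.
apply: rho_le => g; rewrite (mz_sym DP) -{1}[g]add0r; apply/ltW.
apply: (hd (0, g) (x - y, g)); apply/prod_dist_lt => /=.
by rewrite (mz_xx DP).
Qed.

End GroupNorm.

Lemma compact_group_totally_bounded (R : realType) (G : topologicalZmodType)
    (rho : G -> R) : compact [set: G] -> group_seminorm rho ->
  metrizes (fun x y => rho (x - y)) -> totally_bounded_sn rho.
Proof.
move=> cG rhoP rhoM e e0; have [s hs] := mz_totally_bounded rhoM cG e0.
by exists s => x; have [f fs hf] := hs x; exists f => //; rewrite (snBC rhoP).
Qed.

(** The subgroup generated by a ball is open and closed. *)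
Lemma connected_group_chainable (R : realType) (G : topologicalZmodType)
    (rho : G -> R) : connected [set: G] -> group_seminorm rho ->
  metrizes (fun x y => rho (x - y)) -> chainable rho.
Proof.
move=> cG rhoP rhoM e e0.
pose B := [set x : G | exists s : seq G, all (fun t => rho t < e) s /\ x = \sum_(t <- s) t].
have step x y : B x -> rho (y - x) < e -> B y.
  move=> [s [hs xs]] xy; exists (y - x :: s); rewrite /= xy hs big_cons -xs subrK.
  by [].
suff BT : B = [set: G] by move=> x; have : [set: G] x by []; rewrite -BT.
apply: cG.
- by exists 0, [::]; rewrite big_nil.
- exists B; last by rewrite setTI.
  rewrite openE => x Bx; apply/(mz_nbhs rhoM); exists e => // y.
  by rewrite (snBC rhoP); exact: step.
- exists B; last by rewrite setTI.
  move=> x clx; have [y [By /= xy]] := clx _ (mz_ball rhoM x e0).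
  exact: step By xy.
Qed.

(** * Simultaneous approximation by multiples *)

Definition infinite_times (A : set nat) := forall m, exists2 n, (m <= n)%N & A n.

(** Near every point there is a small ball all of whose elements have multiples, at
    times in [A], close to each of the finitely many targets: the ball is shrunk
    once for each target with [multiples_mixing]. *)
Lemma finite_hitting (R : realType) (G : zmodType) (rho : G -> R)
    (A : set nat) (T : seq G) (e : R) :
  group_seminorm rho -> totally_bounded_sn rho -> chainable rho ->
  infinite_times A -> 0 < e -> forall x (d : R), 0 < d ->
  exists y, exists2 d' : R, 0 < d' & forall z, rho (z - y) < d' ->
    rho (z - x) < d /\ forall t, t \in T -> exists2 m, A m & rho (z *+ m - t) < e.
Proof.
move=> rhoP tb ch hA e0 x d d0.
elim: T => [|t T [y [d' d'0 IH]]]; first by exists x, d.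
have m0 : 0 < Num.min (d' / 2) (e / 2) by rewrite lt_min !divr_gt0.
have [N hN] := multiples_mixing rhoP tb ch t y m0.
have [n Nn An] := hA N; have [v] := hN n Nn.
rewrite !lt_min => /andP[v1 _] /andP[_ v2].
have n0 : 0 < n.+1%:R :> R by rewrite ltr0n.
exists v, (Num.min (d' / 2) (e / 2 / n.+1%:R)); first by rewrite lt_min !divr_gt0.
move=> z; rewrite lt_min => /andP[z1 z2].
have zy : rho (z - y) < d' by have := sn_tri rhoP v z y; lra.
have [zx zT] := IH z zy; split=> // w; rewrite inE => /orP[/eqP->|/zT//].
exists n => //.
have h1 := sn_tri rhoP (v *+ n) (z *+ n) t.
have h2 : rho (z *+ n - v *+ n) <= e / 2.
  rewrite -mulrnBl; apply: le_trans (snMn rhoP _ _) _.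
  apply: (@le_trans _ _ (n.+1%:R * rho (z - v))).
    by rewrite ler_wpM2r ?(sn_ge0 rhoP)// ler_nat.
  by rewrite mulrC -ler_pdivlMr// ltW.
by lra.
Qed.

(** The multiples of an element of a finite subgroup repeat. *)
Lemma finite_subgroup_exponent (G : zmodType) (ls : seq G) :
  0 \in ls -> (forall x y, x \in ls -> y \in ls -> x + y \in ls) ->
  exists2 e, (0 < e)%N & forall l, l \in ls -> l *+ e = 0.
Proof.
move=> l0 lD.
have mul l i : l \in ls -> l *+ i \in ls.
  by move=> ll; elim: i => [|i IH]; rewrite ?mulr0n// mulrS lD.
have each l : l \in ls -> exists2 e, (0 < e)%N & l *+ e = 0.
  move=> ll; pose f i := l *+ i.
  have : ~~ uniq (mkseq f (size ls).+1).
    apply/negP => /uniq_leq_size h.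
    have : (size (mkseq f (size ls).+1) <= size ls)%N.
      by apply: h => _ /mapP[i _ ->]; exact: mul.
    by rewrite size_mkseq ltnn.
  move=> /(uniqPn 0)[i [j [ij]]]; rewrite size_mkseq => jn.
  rewrite !nth_mkseq ?(ltn_trans ij)// /f => eij.
  exists (j - i)%N; first by rewrite subn_gt0.
  by rewrite mulrnBr ?(ltnW ij)// eij subrr.
suff [e e0 he] : exists2 e, (0 < e)%N & forall l, l \in ls -> l *+ e = 0 by exists e.
elim: {-2}ls (fun l (h : l \in ls) => h) => [|l s IH] sub; first by exists 1%N.
have [e e0 he] := IH (fun x h => sub x (mem_behead (s := l :: s) h)).
have [f f0 hf] := each l (sub l (mem_head _ _)).
exists (e * f)%N; first by rewrite muln_gt0 e0.
move=> x; rewrite inE => /orP[/eqP->|/he xe]; first by rewrite mulnC mulrnA hf mul0rn.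
by rewrite mulrnA xe mul0rn.
Qed.

(** * Paths in an arcwise connected homeomorphism group *)

Section Paths.
Variables (R : realType) (Z : metricType R).

Definition path_continuous (p : R -> Z -> Z) := forall t (e : R), 0 < e ->
  exists2 d : R, 0 < d & forall t', `|t - t'| < d -> forall z, mdist (p t z) (p t' z) < e.

Lemma path_continuous_cst g : path_continuous (fun=> g).
Proof. by move=> t e e0; exists 1 => // t' _ z; rewrite (mz_xx (mdist_metrizes Z)). Qed.

Lemma path_continuous_shift p c :
  path_continuous p -> path_continuous (fun t => p (t - c)).
Proof.
move=> hp t e /(hp (t - c))[d d0 h]; exists d => // t' tt' z; apply: h.
by rewrite opprB addrA subrK.
Qed.

Lemma path_continuous_paste p1 p2 L : path_continuous p1 -> path_continuous p2 ->
  p1 L = p2 L -> path_continuous (fun t => if t <= L then p1 t else p2 t).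
Proof.
move=> h1 h2 eL t e e0; have [d1 d10 k1] := h1 t e e0; have [d2 d20 k2] := h2 t e e0.
case: (ltgtP t L) => [tL|Lt|tL].
- exists (Num.min d1 (L - t)); first by rewrite lt_min d10 subr_gt0.
  move=> t'; rewrite lt_min => /andP[tt' tt2] z; case: ifPn => [_|]; first exact: k1.
  rewrite -ltNge => Lt'; move: tt2; rewrite distrC ltr_norml => /andP[_].
  by rewrite ltrD2r ltNge (ltW Lt').
- exists (Num.min d2 (t - L)); first by rewrite lt_min d20 subr_gt0.
  move=> t'; rewrite lt_min => /andP[tt' tt2] z; case: ifPn => [t'L|_]; last exact: k2.
  by move: tt2; rewrite ltr_norml => /andP[_]; rewrite ltrD2l ltrN2 ltNge t'L.
- exists (Num.min d1 d2); first by rewrite lt_min d10.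
  move=> t'; rewrite lt_min => /andP[tt1 tt2] z; case: ifPn => _; first exact: k1.
  by rewrite tL eL -tL; exact: k2.
Qed.

Lemma uniform_ball (g : {uniform Z -> Z}) (e : R) : 0 < e ->
  nbhs g [set h : {uniform Z -> Z} | forall z, mdist (g z) (h z) < e].
Proof.
move=> e0; apply/uniform_nbhs.
exists [set xy | ball xy.1 e xy.2]; split.
  exact: (entourage_ball Z (PosNum e0)).
by move=> h /= hz z; have := hz z I; rewrite ballEmdist.
Qed.

(** The arc is prolonged to the whole line by clamping the parameter to the unit
    interval. *)
Lemma arc_path (Ga : set {uniform Z -> Z}) (x y : Z -> Z) :
  arcwise_connected R Ga -> Ga x -> Ga y ->
  exists f : R -> Z -> Z, [/\ path_continuous f, (forall t, Ga (f t)),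
    f 0 = x & f 1 = y].
Proof.
move=> arc Gx Gy; have [<-|xy] := pselect (x = y).
  by exists (fun=> x); split=> //; exact: path_continuous_cst.
have [f [k [fc _ _ [fG f0 f1]]]] := arc x y Gx Gy xy.
pose cl (t : R) : R := Num.max 0 (Num.min t 1).
have cl01 t : cl t \in `[0, 1].
  by rewrite in_itv /= le_max lexx /= ge_max ler01 /= ge_min lexx orbT.
have cl_lip t t' : `|cl t - cl t'| <= `|t - t'|.
  have m01 : Num.max 0 1 = 1 :> R by apply/max_idPr.
  rewrite /cl ler_norml; case: (lerP t' t) => tt'; case: (lerP t 1) => t1;
    case: (lerP t' 1) => t'1; rewrite ?m01;
    try (case: (lerP 0 t) => t0); try (case: (lerP 0 t') => t'0);
    apply/andP; split; lra.
exists (fun t => f (cl t)); split.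
- move=> t e e0; have := cl01 t => ct.
  have /subspace_continuousP/(_ (cl t) ct) := fc.
  move=> /(_ _ (uniform_ball (f (cl t)) e0)) h.
  have /nbhs_ballP[d /= d0 hd] : nbhs (cl t) [set s | `[0, 1]%classic s ->
    forall z, mdist (f (cl t) z) (f s z) < e] by exact: h.
  exists d => // t' tt' z; apply: hd; last exact: cl01.
  exact: le_lt_trans (cl_lip t t') tt'.
- by move=> t; apply: fG; exists (cl t) => //; exact: cl01.
- by rewrite /cl /Num.min ltr01 /Num.max ltxx.
- by rewrite /cl /Num.min ltxx /Num.max ltr01.
Qed.

(** Finitely many arcs are run one after the other, starting from the identity.
    Being the identity for negative times lets the path be used as the value of a
    bump that vanishes outside a ball. *)
Lemma path_through (Ga : set {uniform Z -> Z}) (s : seq Z) (g : Z -> Z -> Z) :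
  arcwise_connected R Ga -> Ga id -> (forall x, Ga (g x)) ->
  exists p : R -> Z -> Z, exists2 L : R, 0 < L &
  [/\ path_continuous p, (forall t, Ga (p t)), (forall t, t <= 0 -> p t = id) &
      forall x, x \in s -> exists2 t, 0 <= t <= L & p t = g x].
Proof.
move=> arc Gid Gg; elim: s => [|x s [p [L L0 [pc pG p0 ps]]]].
  by exists (fun=> id), 1 => //; split=> //; exact: path_continuous_cst.
have [f [fc fG f0 f1]] := arc_path arc (pG L) (Gg x).
exists (fun t => if t <= L then p t else f (t - L)), (L + 1).
  by rewrite ltr_wpDr.
split.
- apply: path_continuous_paste => //; first exact: path_continuous_shift.
  by rewrite subrr.
- by move=> t; case: ifP.
- by move=> t t0; rewrite (le_trans t0 (ltW L0)) p0.
- move=> y; rewrite inE => /orP[/eqP->|/ps[t tL pt]].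
    exists (L + 1); first by rewrite lexx andbT addr_ge0// ltW.
    by rewrite gerDl ler10 addrC addKr f1.
  exists t; first by lra.
  by have -> : t <= L by lra.
Qed.

Let RP := @real_metrizes R.
Let ZP := mdist_metrizes Z.
Let RZP := prod_metrizes RP ZP.

Lemma path_joint_continuous p : path_continuous p -> (forall t, continuous (p t)) ->
  continuous (fun x : R * Z => p x.1 x.2).
Proof.
move=> pc pcz; apply/(continuousP_eps RZP ZP) => -[t z] e e0 /=.
have e20 : 0 < e / 2 by rewrite divr_gt0.
have [d d0 hd] := pc t _ e20.
have [d' d'0 hd'] := (continuousP_eps ZP ZP (p t)).1 (pcz t) z _ e20.
exists (Num.min d d'); first by rewrite lt_min d0.
move=> [t' z'] /prod_dist_lt /= [h1 h2].
rewrite lt_min in h1; rewrite lt_min in h2.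
have [/andP[h1' _] /andP[_ h2']] := (h1, h2).
have := mz_tri ZP (p t z') (p t z) (p t' z').
by have := hd _ h1' z'; have := hd' _ h2'; lra.
Qed.

Lemma path_inverse_joint_continuous p p' : path_continuous p ->
  (forall t, continuous (p' t)) ->
  (forall t, cancel (p t) (p' t)) -> (forall t, cancel (p' t) (p t)) ->
  continuous (fun x : R * Z => p' x.1 x.2).
Proof.
move=> pc p'c pK p'K; apply/(continuousP_eps RZP ZP) => -[t z] e e0 /=.
have [d d0 hd] := (continuousP_eps ZP ZP (p' t)).1 (p'c t) z _ e0.
have d20 : 0 < d / 2 by rewrite divr_gt0.
have [d' d'0 hd'] := pc t _ d20.
exists (Num.min (d / 2) d'); first by rewrite lt_min d20.
move=> [t' z'] /prod_dist_lt /= [h1 h2].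
rewrite lt_min in h1; rewrite lt_min in h2.
have [/andP[_ h1'] /andP[h2' _]] := (h1, h2).
rewrite -[p' t' z'](pK t); apply: hd.
have := hd' _ h1' (p' t' z'); rewrite p'K => h3.
by have := mz_tri ZP z' z (p t (p' t' z')); rewrite (mz_sym ZP z' (p _ _)); lra.
Qed.

End Paths.

(** * Equivariant cocycles supported near a finite subgroup *)

Section Cocycle.
Variables (R : realType) (Gamma : topologicalZmodType) (rho : Gamma -> R).
Hypotheses (rhoP : group_seminorm rho) (rhoM : metrizes (fun x y => rho (x - y))).
Variable Z : metricType R.
Variables (ls : seq Gamma) (q : Gamma -> Z -> Z).
Hypotheses (ls_uniq : uniq ls) (ls0 : 0 \in ls)
  (lsB : forall x y, x \in ls -> y \in ls -> x - y \in ls).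
Hypotheses (q_cont : forall l, l \in ls -> continuous (q l))
  (qD : forall l m, l \in ls -> m \in ls -> q (l + m) = q l \o q m)
  (q0 : q 0 = id).

Let lsN x : x \in ls -> - x \in ls.
Proof. by move=> xl; rewrite -sub0r lsB. Qed.

Let lsD x y : x \in ls -> y \in ls -> x + y \in ls.
Proof. by move=> xl yl; rewrite -[y]opprK lsB ?lsN. Qed.

Let qK l : l \in ls -> cancel (q l) (q (- l)).
Proof.
move=> ll z; have := qD (lsN ll) ll.
by rewrite addNr q0 => /(congr1 (@^~ z)) /= <-.
Qed.

Let qNK l : l \in ls -> cancel (q (- l)) (q l).
Proof. by move=> ll z; rewrite -{1}[l]opprK qK ?lsN. Qed.

Lemma seminorm_continuous : continuous rho.
Proof.
apply/(continuousP_eps rhoM (@real_metrizes R)) => x e e0; exists e => // y xy.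
exact: le_lt_trans (sn_lip rhoP x y) xy.
Qed.

Variables (L r : R).
Hypotheses (L0 : 0 < L) (r0 : 0 < r)
  (r_sep : forall l, l \in ls -> l != 0 -> 2 * r <= rho l).

(** Time at which the path [p] is read: [L] at the centre, and negative, where [p] is
    the identity, outside the ball of radius [r]. *)
Definition bump (x : Gamma) : R := L * (1 - rho x / r).

Definition bump_factor (p : R -> Z -> Z) (l x : Gamma) (z : Z) : Z :=
  q l (p (bump (x - l)) (q (- l) z)).

(** The conjugates by [q l] of a bump around [l] are composed over all [l] in [s].
    Their supports are disjoint, so at each point at most one factor is not the
    identity; the composition makes joint continuity immediate. *)
Definition cocycle (p : R -> Z -> Z) (s : seq Gamma) (x : Gamma) (z : Z) : Z :=
  foldr (fun l => bump_factor p l x) z s.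

Definition cocycle_inv (p' : R -> Z -> Z) (s : seq Gamma) (x : Gamma) (z : Z) : Z :=
  foldl (fun z l => bump_factor p' l x z) z s.

Lemma bump_continuous l : continuous (fun x => bump (x - l)).
Proof.
move=> x; rewrite /bump; apply: cvgM; first exact: cvg_cst.
apply: cvgB; first exact: cvg_cst.
apply: cvgM; last exact: cvg_cst.
apply: (@continuous_comp _ _ _ (fun x => x - l) rho); last exact: seminorm_continuous.
apply: (@continuous_comp _ _ _ (fun y : Gamma => (y, - l)) (fun p : Gamma * Gamma => p.1 + p.2));
  last exact: add_continuous.
by apply: pair_continuous; [exact: cvg_id | exact: cvg_cst].
Qed.

Lemma bump_factor_continuous p l : l \in ls ->
  continuous (fun x : R * Z => p x.1 x.2) ->
  continuous (fun x : Gamma * Z => bump_factor p l x.1 x.2).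
Proof.
move=> ll pc x; rewrite /bump_factor.
apply: (@continuous_comp _ _ _ (fun x : Gamma * Z => p (bump (x.1 - l)) (q (- l) x.2)) (q l));
  last exact: q_cont.
apply: (@continuous_comp _ _ _ (fun x : Gamma * Z => (bump (x.1 - l), q (- l) x.2))
   (fun x : R * Z => p x.1 x.2)); last exact: pc.
apply: pair_continuous.
  apply: (@continuous_comp _ _ _ fst (fun x => bump (x - l))); first exact: cvg_fst.
  exact: bump_continuous.
apply: (@continuous_comp _ _ _ snd (q (- l))); first exact: cvg_snd.
by apply: q_cont; exact: lsN.
Qed.

Lemma cocycle_continuous p s : {subset s <= ls} ->
  continuous (fun x : R * Z => p x.1 x.2) ->
  continuous (fun x : Gamma * Z => cocycle p s x.1 x.2).
Proof.
move=> sub pc; elim: s sub => [|l s IH] sub x; first exact: cvg_snd.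
apply: (@continuous_comp _ _ _ (fun x : Gamma * Z => (x.1, cocycle p s x.1 x.2))
   (fun x : Gamma * Z => bump_factor p l x.1 x.2)).
  apply: pair_continuous; first exact: cvg_fst.
  by apply: IH => m ms; apply: sub; rewrite inE ms orbT.
by apply: bump_factor_continuous => //; apply: sub; rewrite mem_head.
Qed.

Lemma cocycle_inv_continuous p s : {subset s <= ls} ->
  continuous (fun x : R * Z => p x.1 x.2) ->
  continuous (fun x : Gamma * Z => cocycle_inv p s x.1 x.2).
Proof.
move=> sub pc; elim: s sub => [|l s IH] sub x; first exact: cvg_snd.
apply: (@continuous_comp _ _ _ (fun x : Gamma * Z => (x.1, bump_factor p l x.1 x.2))
   (fun x : Gamma * Z => cocycle_inv p s x.1 x.2)).
  apply: pair_continuous; first exact: cvg_fst.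
  by apply: bump_factor_continuous => //; apply: sub; rewrite mem_head.
by apply: IH => m ms; apply: sub; rewrite inE ms orbT.
Qed.

Section Inverse.
Variables p p' : R -> Z -> Z.
Hypotheses (pK : forall t, cancel (p t) (p' t)) (p'K : forall t, cancel (p' t) (p t)).

Lemma cocycleK s x : {subset s <= ls} -> cancel (cocycle p s x) (cocycle_inv p' s x).
Proof.
elim: s => [//|l s IH] sub z /=; rewrite /bump_factor qK ?pK ?qNK.
- by apply: IH => m ms; apply: sub; rewrite inE ms orbT.
- by apply: sub; rewrite mem_head.
- by apply: sub; rewrite mem_head.
Qed.

Lemma cocycle_invK s x : {subset s <= ls} -> cancel (cocycle_inv p' s x) (cocycle p s x).
Proof.
elim: s => [//|l s IH] sub z /=; rewrite IH => [|m ms]; last first.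
  by apply: sub; rewrite inE ms orbT.
by rewrite /bump_factor qK ?p'K ?qNK//; apply: sub; rewrite mem_head.
Qed.

End Inverse.

Section Support.
Variable p : R -> Z -> Z.
Hypothesis p_id : forall t, t <= 0 -> p t = id.

Lemma bump_factor_id l x z : l \in ls -> r <= rho (x - l) -> bump_factor p l x z = z.
Proof.
move=> ll rx; rewrite /bump_factor p_id ?qNK// /bump.
by rewrite pmulr_rle0// subr_le0 ler_pdivlMr// mul1r.
Qed.

Lemma cocycle_id s x z : {subset s <= ls} -> (forall l, l \in s -> r <= rho (x - l)) ->
  cocycle p s x z = z.
Proof.
elim: s => [//|l s IH] sub h /=; rewrite IH.
- by apply: bump_factor_id; [apply: sub | apply: h]; rewrite mem_head.
- by move=> m ms; apply: sub; rewrite inE ms orbT.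
- by move=> m ms; apply: h; rewrite inE ms orbT.
Qed.

Lemma cocycle_one l x z : l \in ls ->
  (forall m, m \in ls -> m != l -> r <= rho (x - m)) ->
  cocycle p ls x z = bump_factor p l x z.
Proof.
move=> ll h; suff key s : {subset s <= ls} -> uniq s -> l \in s ->
  cocycle p s x z = bump_factor p l x z by exact: key.
elim: s => [//|m s IH] sub /= /andP[ms us]; rewrite inE => /orP[/eqP lm|ls'].
  rewrite -lm in ms *; rewrite cocycle_id// => k ks.
    by apply: sub; rewrite inE ks orbT.
  apply: h; first by apply: sub; rewrite inE ks orbT.
  by apply: contraNneq ms => <-.
rewrite IH//; last by move=> k ks; apply: sub; rewrite inE ks orbT.
have mls : m \in ls by apply: sub; rewrite mem_head.
apply: bump_factor_id => //; apply: h => //.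
by apply: contraNneq ms => ->.
Qed.

Lemma separated_far l m x : l \in ls -> m \in ls -> m != l -> rho (x - l) <= r ->
  r <= rho (x - m).
Proof.
move=> ll ml ne h; have := r_sep (lsB ml ll); rewrite subr_eq0 => /(_ ne).
by have := sn_tri rhoP x m l; rewrite (snBC rhoP m x); lra.
Qed.

(** Translation by [l] carries the factor around [m] to the factor around [l + m],
    since [q (l + m)] is [q l \o q m]. *)
Lemma cocycle_equivariant l x z : l \in ls ->
  cocycle p ls (l + x) (q l z) = q l (cocycle p ls x z).
Proof.
move=> ll.
have [[m [ml hm]]|no] := pselect (exists m, m \in ls /\ rho (x - m) <= r).
  rewrite [in RHS](@cocycle_one m)// => [|k kl km]; last exact: separated_far ml kl km hm.
  have hlm : l + x - (l + m) = x - m by rewrite opprD addrACA subrr add0r.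
  rewrite (@cocycle_one (l + m)) ?lsD// => [|k kl km]; last first.
    by apply: (@separated_far (l + m)); rewrite ?lsD ?hlm.
  rewrite /bump_factor hlm qD//= opprD (addrC (- l)) qD ?lsN//=.
  by rewrite qK.
have far m : m \in ls -> r <= rho (x - m).
  by move=> ml; rewrite leNgt; apply/negP => h; apply: no; exists m; split=> //; exact: ltW.
rewrite !cocycle_id// => m ml.
have -> : l + x - m = x - (m - l) by rewrite opprB [RHS]addrCA addrA.
by apply: far; exact: lsB.
Qed.

Lemma cocycle_value x z : rho x <= r -> cocycle p ls x z = p (bump x) z.
Proof.
move=> xr; rewrite (@cocycle_one 0)// => [|m ml m0].
  by rewrite /bump_factor subr0 oppr0 q0.
by apply: (@separated_far 0) => //; rewrite subr0.
Qed.

End Support.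

End Cocycle.

(** * Perturbing a rotation of the product *)

Section Rotations.
Variables (R : realType) (Gamma : topologicalZmodType) (rho : Gamma -> R).
Hypotheses (rhoP : group_seminorm rho) (rhoM : metrizes (fun x y => rho (x - y))).
Hypotheses (Gamma_compact : compact [set: Gamma])
  (Gamma_connected : connected [set: Gamma])
  (Gamma_infinite : infinite_set [set: Gamma]).
Variable Z : metricType R.
Hypothesis Z_compact : compact [set: Z].
Variables (ls : seq Gamma) (q : Gamma -> Z -> Z).
Hypotheses (ls_uniq : uniq ls) (ls0 : 0 \in ls)
  (lsB : forall x y, x \in ls -> y \in ls -> x - y \in ls).
Hypotheses (q_cont : forall l, l \in ls -> continuous (q l))
  (qD : forall l m, l \in ls -> m \in ls -> q (l + m) = q l \o q m)
  (q0 : q 0 = id).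
Variable Ga : set {uniform Z -> Z}.
Hypotheses (Ga_subgroup : homeo_subgroup Ga) (Ga_arc : arcwise_connected R Ga)
  (Ga_minimal : minimal_action Ga).

Let ZP := mdist_metrizes Z.
Let tb := compact_group_totally_bounded Gamma_compact rhoP rhoM.
Let ch := connected_group_chainable Gamma_connected rhoP rhoM.

Lemma seminorm_onto (v : R) y : 0 <= v <= rho y -> exists x, rho x = v.
Proof.
move=> vy.
have : connected (rho @` [set: Gamma]).
  apply: connected_continuous_connected => //; apply: continuous_subspaceT.
  exact: seminorm_continuous rhoP rhoM.
move=> /connected_intervalP/(_ 0 (rho y)) h.
have [||x _ <-] := h _ _ v vy; last by exists x.
  by exists 0 => //; rewrite (sn0 rhoP).
by exists y.
Qed.

Lemma separation_radius : exists2 r : R, 0 < r &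
  (exists y, r <= rho y) /\ forall l, l \in ls -> l != 0 -> 2 * r <= rho l.
Proof.
have [y /eqP y0] : exists y : Gamma, y <> 0.
  apply: contrapT => h; apply: Gamma_infinite.
  rewrite (_ : [set: Gamma] = [set 0]); first exact: finite_set1.
  apply/seteqP; split=> // x _ /=; apply: contrapT => x0; apply: h; by exists x.
have pos x : x != 0 -> 0 < rho x.
  move=> x0; rewrite lt_neqAle (sn_ge0 rhoP) andbT eq_sym.
  apply/negP => /eqP xx; move/eqP: x0; apply; apply: (mz_eq rhoM).
  by rewrite subr0.
have [|e e0 he] := @seq_min_pos R _ (y :: [seq l <- ls | l != 0]) rho.
  move=> x; rewrite inE mem_filter => /orP[/eqP->|/andP[x0 _]]; exact: pos.
exists (e / 2); first by rewrite divr_gt0.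
split.
  by exists y; have := he y (mem_head _ _); lra.
move=> l ll l0; have := he l; rewrite inE mem_filter ll l0 orbT => /(_ isT); lra.
Qed.

(** By minimality and compactness finitely many elements [g x] of [Ga] suffice to
    bring every point of [Z] near [zu].  A path through these elements, read by
    bumps around the finite subgroup, takes each of them as a value because the
    seminorm of a connected group takes all intermediate values. *)
Lemma hitting_cocycle (zu : Z) (e : R) : 0 < e ->
  exists K K' : Gamma -> Z -> Z, exists2 cs : seq Gamma,
    [/\ continuous (fun x : Gamma * Z => K x.1 x.2),
        continuous (fun x : Gamma * Z => K' x.1 x.2),
        (forall x, cancel (K x) (K' x)), (forall x, cancel (K' x) (K x)) &
        forall l x z, l \in ls -> K (l + x) (q l z) = q l (K x z)] &
    forall z, exists2 c, c \in cs & mdist (K c z) zu < e.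
Proof.
move=> e0; have [Ghomeo Gid _ _] := Ga_subgroup.
have /choice[g hg] : forall z, exists g, Ga g /\ mdist (g z) zu < e.
  move=> z; have zuB := mz_ball ZP zu e0.
  have [//|y [yB [g Gg gy]]] := Ga_minimal z _ (open_interior [set y | mdist zu y < e]).
    by exists zu.
  by exists g; split=> //; rewrite gy (mz_sym ZP); exact: (interior_subset yB).
have Gc f : Ga f -> continuous f by move=> /Ghomeo[f' []].
have [s hs] : exists s : seq Z, forall z, exists2 x, x \in s & mdist (g x z) zu < e.
  apply: (@compact_finite_cover _ (fun x => [set z | mdist (g x z) zu < e]) Z_compact) => x.
  have [Gx gx] := hg x.
  have e'0 : 0 < e - mdist (g x x) zu by rewrite subr_gt0.
  have := Gc _ Gx x _ (mz_ball ZP (g x x) e'0).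
  apply: (@filterS _ (nbhs x)) => z /= hz.
  by have := mz_tri ZP (g x x) (g x z) zu; rewrite (mz_sym ZP (g x z) (g x x)); lra.
have [p [L L0 [pc pG p_id ps]]] := path_through s Ga_arc Gid (fun x => (hg x).1).
have /choice[p' hp'] : forall t, exists p', [/\ continuous (p t), continuous p',
    cancel (p t) p' & cancel p' (p t)].
  by move=> t; have [p' [? ? ? ?]] := Ghomeo _ (pG t); exists p'.
have pcz t : continuous (p t) by case: (hp' t).
have p'cz t : continuous (p' t) by case: (hp' t).
have pK t : cancel (p t) (p' t) by case: (hp' t).
have p'K t : cancel (p' t) (p t) by case: (hp' t).
have pj := path_joint_continuous pc pcz.
have p'j := path_inverse_joint_continuous pc p'cz pK p'K.
have [r r0 [[y ry] r_sep]] := separation_radius.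
have /choice[c hc] : forall x, exists c, x \in s -> exists2 t, p t = g x &
    rho c <= r /\ bump rho L r c = t.
  move=> x; have [xs|_] := boolP (x \in s); last by exists 0.
  have [t /andP[t0 tL] pt] := ps x xs.
  have tL1 : t / L <= 1 by rewrite ler_pdivrMr// mul1r.
  have tL0 : 0 <= t / L by rewrite divr_ge0// ltW.
  have [|v hv] := @seminorm_onto (r * (1 - t / L)) y.
    rewrite mulr_ge0 ?subr_ge0 ?(ltW r0)//=; apply: le_trans ry.
    by rewrite ger_pMr// gerBl.
  exists v => _; exists t => //; rewrite hv ger_pMr// gerBl tL0; split=> //.
  rewrite /bump hv [r * _]mulrC mulfK ?gt_eqF// opprB addrCA subrr addr0.
  by rewrite mulrC divfK ?gt_eqF.
exists (cocycle rho q L r p ls), (cocycle_inv rho q L r p' ls), [seq c x | x <- s].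
  split.
  - exact: (cocycle_continuous rhoP rhoM ls0 lsB q_cont (fun _ h => h) pj).
  - exact: (cocycle_inv_continuous rhoP rhoM ls0 lsB q_cont (fun _ h => h) p'j).
  - by move=> x; exact: (cocycleK rho ls0 lsB qD q0 L r pK x (fun _ h => h)).
  - by move=> x; exact: (cocycle_invK rho ls0 lsB qD q0 L r p'K x (fun _ h => h)).
  - move=> l x z ll.
    exact: (cocycle_equivariant rhoP ls_uniq ls0 lsB qD q0 L0 r0 r_sep p_id).
move=> z; have [x xs hx] := hs z; exists (c x); first exact: map_f.
have [t pt [cr ct]] := hc x xs.
by rewrite (cocycle_value rhoP ls_uniq ls0 lsB qD q0 L0 r0 r_sep p_id _ cr) ct pt.
Qed.

Let W := (Gamma * Z)%type.
Definition wdist : W -> W -> R := prod_dist (fun x y => rho (x - y)) (@mdist R Z).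

Lemma wdist_metrizes : metrizes wdist.
Proof. exact: prod_metrizes. Qed.

Definition rot (g : Gamma) (w : W) : W := (g + w.1, w.2).

Definition equivariant (F : W -> W) :=
  forall l w, l \in ls -> F (diagonal_map q l w) = diagonal_map q l (F w).

(** The conjugating map is [(x, z) |-> (x, K' (x *+ n) z)] with [K] given by
    [hitting_cocycle], for a large [n].  By mixing of multiples, [g] can be chosen
    near [g0] with [g *+ n] nearly zero; then [K] is evaluated before and after the
    rotation at nearly equal points, so that the conjugate is close to the rotation
    by [g0].  Again by mixing, all the points [c], at which [K] takes the values
    that send points of [Z] near [uz], are approximated by [n]-th multiples of
    points [v c] near [ug]; and [finite_hitting] makes the orbit of every point
    under the rotation by [g], at times in [A], pass near each [v c].  Taking [n]
    congruent to 1 modulo the exponent of the finite subgroup makes multiplication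
    by [n] the identity there, and the conjugating map equivariant. *)
Lemma rotation_perturbation (g0 : Gamma) (e : R) (u : W) (eu : R) (A : set nat) :
  0 < e -> 0 < eu -> infinite_times A ->
  exists H H' : W -> W, exists2 g : Gamma,
    [/\ continuous H, continuous H', cancel H H', cancel H' H & equivariant H] &
    [/\ (forall w, wdist (H' (rot g (H w))) (rot g0 w) < e),
        (forall w, wdist (H' (rot (- g) (H w))) (rot (- g0) w) < e) &
        forall w, exists2 m, A m & wdist (H' (rot (g *+ m) (H w))) u < eu].
Proof.
move=> e0 eu0 hA; case: u => ug uz.
have eu20 : 0 < eu / 2 by rewrite divr_gt0.
have e20 : 0 < e / 2 by rewrite divr_gt0.
have [K [K' [cs [Kc K'c KK K'K Keq] hcs]]] := hitting_cocycle uz eu20.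
have m0 : 0 < Num.min e (eu / 2) by rewrite lt_min e0.
have [d d0 hd] := compact_unif_continuous wdist_metrizes ZP
  (compact_setT_prod Gamma_compact Z_compact) Kc m0.
have hK x y z : rho (x - y) < d ->
    mdist (K x z) (K y z) < e /\ mdist (K x z) (K y z) < eu / 2.
  move=> xy; apply/andP; rewrite -lt_min; apply: (hd (x, z) (y, z)).
  by apply/prod_dist_lt; rewrite /= (mz_xx ZP).
have d20 : 0 < d / 2 by rewrite divr_gt0.
have lsD x y : x \in ls -> y \in ls -> x + y \in ls.
  by move=> xl yl; rewrite -[y]opprK lsB// -sub0r lsB.
have [k k0 hk] := finite_subgroup_exponent ls0 lsD.
pose m1 := Num.min (e / 2) (d / 2).
have m10 : 0 < m1 by rewrite lt_min e20.
have [N1 hN1] := multiples_mixing rhoP tb ch 0 g0 m10.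
pose m2 := Num.min (eu / 2) (d / 2).
have m20 : 0 < m2 by rewrite lt_min eu20.
have [N2 hN2] : exists N2, forall n, (N2 <= n)%N -> forall c, c \in cs ->
    exists2 v, rho (v - ug) < m2 & rho (v *+ n - c) < m2.
  elim: (cs) => [|c s [N IH]]; first by exists 0%N.
  have [N' hN'] := multiples_mixing rhoP tb ch c ug m20.
  exists (maxn N N') => n; rewrite geq_max => /andP[Nn N'n] x.
  by rewrite inE => /orP[/eqP->|xs]; [exact: hN' | exact: IH].
pose n := (k * maxn N1 N2 + 1)%N.
have maxn_n : (maxn N1 N2 <= n)%N by rewrite /n addn1 leqW// leq_pmull.
have n1 : (N1 <= n)%N by apply: leq_trans maxn_n; rewrite leq_maxl.
have n2 : (N2 <= n)%N by apply: leq_trans maxn_n; rewrite leq_maxr.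
have n0 : 0 < n%:R :> R by rewrite ltr0n /n addn1.
have hn l : l \in ls -> l *+ n = l.
  by move=> ll; rewrite /n addn1 mulrS mulrnA hk// mul0rn addr0.
(* [g1] satisfies both closeness conditions with room to spare; [g] will be a
   point near [g1] that also satisfies the hitting conditions. *)
have [g1 g1a] := hN1 n n1; rewrite subr0 => g1b.
move: g1a g1b; rewrite !lt_min => /andP[g1a _] /andP[_ g1b].
have /choice[v hv] : forall c, exists v, c \in cs ->
    rho (v - ug) < m2 /\ rho (v *+ n - c) < m2.
  move=> c; have [ccs|_] := boolP (c \in cs); last by exists 0.
  by have [v v1 v2] := hN2 n n2 c ccs; exists v.
pose d2 := Num.min (Num.min (e / 2) (eu / 2)) (d / 2 / n%:R).
have d2_0 : 0 < d2 by rewrite !lt_min e20 eu20 divr_gt0.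
have d2_e : d2 <= e / 2 by rewrite !ge_min lexx.
have d2_eu : d2 <= eu / 2 by rewrite !ge_min lexx !orbT.
have d2_d : n%:R * d2 <= d / 2.
  by rewrite mulrC -ler_pdivlMr// !ge_min lexx !orbT.
have d2h : 0 < d2 / 2 by rewrite divr_gt0.
have [S netS] := tb d2h.
(* Moving from any point [x] to [v c] takes a translation by [v c - x], and [x] is
   close to some [a] in the net [S]. *)
pose T := [seq v c - a | c <- cs, a <- S].
have [g [d' d'0 hg']] := finite_hitting T rhoP tb ch hA d2h g1 d2_0.
have [gg1 hgT] : rho (g - g1) < d2 /\ forall t, t \in T ->
    exists2 m, A m & rho (g *+ m - t) < d2 / 2.
  by apply: hg'; rewrite subrr (sn0 rhoP).
have gg0 : rho (g - g0) < e.
  by have := sn_tri rhoP g1 g g0; lra.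
have mul_lt x y : rho (x - y) < d2 -> rho (x *+ n - y *+ n) < d / 2.
  move=> xy; rewrite -mulrnBl; apply: le_lt_trans (snMn rhoP _ _) _.
  by apply: lt_le_trans d2_d; rewrite ltr_pM2l.
have gn : rho (g *+ n) < d.
  have := mul_lt _ _ gg1; have := snD rhoP (g *+ n - g1 *+ n) (g1 *+ n).
  by rewrite subrK; lra.
pose H (w : W) : W := (w.1, K' (w.1 *+ n) w.2).
pose H' (w : W) : W := (w.1, K (w.1 *+ n) w.2).
have muln_c : continuous (fun x : Gamma => x *+ n).
  apply/(continuousP_eps rhoM rhoM) => x b b0.
  exists (b / n%:R); first by rewrite divr_gt0.
  move=> y xy; rewrite -mulrnBl; apply: le_lt_trans (snMn rhoP _ _) _.
  by rewrite mulrC -ltr_pdivlMr.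
have fib_c (F : Gamma -> Z -> Z) : continuous (fun x : Gamma * Z => F x.1 x.2) ->
    continuous (fun w : W => (w.1, F (w.1 *+ n) w.2)).
  move=> Fc w; apply: pair_continuous; first exact: cvg_fst.
  apply: (@continuous_comp _ _ _ (fun w : W => (w.1 *+ n, w.2))
    (fun x : Gamma * Z => F x.1 x.2)); last exact: Fc.
  apply: pair_continuous; last exact: cvg_snd.
  by apply: (@continuous_comp _ _ _ fst (fun x : Gamma => x *+ n));
    [exact: cvg_fst | exact: muln_c].
have H'rot x w : H' (rot x (H w)) =
    (x + w.1, K (x *+ n + w.1 *+ n) (K' (w.1 *+ n) w.2)).
  by rewrite /H' /rot /H /= mulrnDl.
have close x x0 w : rho (x - x0) < e -> rho (x *+ n) < d ->
    wdist (H' (rot x (H w))) (rot x0 w) < e.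
  move=> xx0 xn; rewrite H'rot; apply/prod_dist_lt; rewrite /= opprD addrACA subrr addr0.
  split=> //; rewrite -{2}[w.2](K'K (w.1 *+ n)).
  by apply: (hK _ _ _ _).1; rewrite addrK.
exists H, H', g; split=> //.
- exact: fib_c.
- exact: fib_c.
- by move=> [x z]; rewrite /H /H' /= K'K.
- by move=> [x z]; rewrite /H /H' /= KK.
- move=> l [x z] ll; rewrite /H /diagonal_map /= mulrnDl (hn _ ll); congr pair.
  by rewrite -{1}[z](K'K (x *+ n)) -Keq// KK.
- by move=> w; exact: close.
- by move=> w; apply: close; [rewrite -opprD (snN rhoP) | rewrite mulNrn (snN rhoP)].
move=> w; set y := K' (w.1 *+ n) w.2.
have [c ccs hc] := hcs y.
have [a aS ha] := netS w.1.
have [m Am hm] := hgT (v c - a) (allpairs_f (fun c a => v c - a) ccs aS).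
exists m => //; rewrite H'rot -/y; apply/prod_dist_lt => /=.
have [v1 v2] := hv c ccs; move: v1 v2; rewrite !lt_min => /andP[v1 _] /andP[_ v2].
set x := g *+ m + w.1.
have xv : rho (x - v c) < d2.
  have := snD rhoP (g *+ m - (v c - a)) (w.1 - a).
  have -> : g *+ m - (v c - a) + (w.1 - a) = x - v c.
    by rewrite opprB addrACA (addrAC a) subrr sub0r.
  by lra.
split.
  by have := sn_tri rhoP (v c) x ug; lra.
rewrite -mulrnDl -/x.
have xc : rho (x *+ n - c) < d.
  by have := sn_tri rhoP (v c *+ n) (x *+ n) c; have := mul_lt _ _ xv; lra.
have [_ h1] := hK _ _ y xc.
by have := mz_tri ZP (K c y) (K (x *+ n) y) uz; lra.
Qed.

End Rotations.

(** * Generic limits of conjugate rotations *)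

Section UniformLimits.
Variables (R : realType) (W : topologicalType) (D : W -> W -> R).
Hypotheses (DM : metrizes D) (W_compact : compact [set: W]).

Lemma iter_stability (F : W -> W) m (e : R) : continuous F -> 0 < e ->
  exists2 d : R, 0 < d & forall G, (forall w, D (F w) (G w) < d) ->
    forall w, D (iter m F w) (iter m G w) < e.
Proof.
move=> Fc; elim: m e => [|m IH] e e0.
  by exists 1 => // G _ w; rewrite (mz_xx DM).
have e20 : 0 < e / 2 by rewrite divr_gt0.
have [d d0 hd] := compact_unif_continuous DM DM W_compact Fc e20.
have [d' d'0 hd'] := IH d d0.
exists (Num.min d' (e / 2)); first by rewrite lt_min d'0.
move=> G hG w /=.
have hG' v : D (F v) (G v) < d' /\ D (F v) (G v) < e / 2.
  by have := hG v; rewrite lt_min => /andP.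
have h1 := hd _ _ (hd' G (fun v => (hG' v).1) w).
have [_ h2] := hG' (iter m G w).
by have := mz_tri DM (F (iter m G w)) (F (iter m F w)) (G (iter m G w)); lra.
Qed.

Lemma iter_continuous (F : W -> W) m : continuous F -> continuous (iter m F).
Proof.
move=> Fc; elim: m => [|m IH] w; first exact: cvg_id.
by apply: (@continuous_comp _ _ _ (iter m F) F); [exact: IH | exact: Fc].
Qed.

(** By compactness finitely many times serve all the starting points, and finitely
    many iterates are controlled by uniform closeness of the maps. *)
Lemma hitting_stability (F : W -> W) (A : set nat) u (e : R) : continuous F -> 0 < e ->
  (forall w, exists2 m, A m & D (iter m F w) u < e) ->
  exists2 d : R, 0 < d & forall G, (forall w, D (F w) (G w) < d) ->
    forall w, exists2 m, A m & D (iter m G w) u < 2 * e.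
Proof.
move=> Fc e0 hitF.
have /choice[f hf] : forall w, exists m, A m /\ D (iter m F w) u < e.
  by move=> w; have [m Am hm] := hitF w; exists m.
have Af w : A (f w) by case: (hf w).
have hit w : D (iter (f w) F w) u < e by case: (hf w).
have [s hs] : exists s : seq W, forall w, exists2 x, x \in s & D (iter (f x) F w) u < e.
  apply: (@compact_finite_cover _ (fun x => [set w | D (iter (f x) F w) u < e]) W_compact) => x.
  have d0 : 0 < e - D (iter (f x) F x) u by rewrite subr_gt0.
  have := @iter_continuous F (f x) Fc x _ (mz_ball DM (iter (f x) F x) d0).
  apply: (@filterS _ (nbhs x)) => w /= hw.
  have := mz_tri DM (iter (f x) F x) (iter (f x) F w) u.
  by rewrite (mz_sym DM (iter (f x) F w) (iter (f x) F x)); lra.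
have /choice[d hd] : forall x, exists d : R, 0 < d /\
    forall G, (forall w, D (F w) (G w) < d) ->
    forall w, D (iter (f x) F w) (iter (f x) G w) < e.
  by move=> x; have [d d0 h] := iter_stability (f x) Fc e0; exists d.
have [r r0 hr] := @seq_min_pos R W s d (fun x _ => (hd x).1).
exists r => // G hG w; have [x xs hx] := hs w.
exists (f x) => //.
have h : D (iter (f x) F w) (iter (f x) G w) < e.
  by apply: (hd x).2 => v; apply: lt_le_trans (hG v) (hr x xs).
have := mz_tri DM (iter (f x) F w) (iter (f x) G w) u.
by rewrite (mz_sym DM (iter (f x) G w) (iter (f x) F w)); lra.
Qed.

(** A Baire category argument in the closure of the class [C] of pairs (map,
    inverse).  The successive approximations carry a radius [ep], at least halved at
    each step, such that the condition obtained at step [j] survives in the ball of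
    radius [2 * ep], which contains the limit.  The inverses are controlled along
    with the maps so that the limit is invertible. *)
Lemma baire_limit (C : (W -> W) -> (W -> W) -> Prop) (O : nat -> (W -> W) -> Prop) :
  (exists F F', C F F') ->
  (forall F F' j (e : R), C F F' -> 0 < e -> exists G G', [/\ C G G',
     (forall w, D (F w) (G w) < e), (forall w, D (F' w) (G' w) < e) &
     exists2 d : R, 0 < d & forall H, (forall w, D (G w) (H w) < d) -> O j H]) ->
  exists F F', (forall j, O j F) /\ forall e : R, 0 < e -> exists G G',
    [/\ C G G', (forall w, D (F w) (G w) < e) & forall w, D (F' w) (G' w) < e].
Proof.
move=> [F0 [F0' C0]] dens.
pose S := {x : (W -> W) * (W -> W) * R | C x.1.1 x.1.2 /\ 0 < x.2}.
pose fw (x : S) := (sval x).1.1; pose bw (x : S) := (sval x).1.2.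
pose ep (x : S) : R := (sval x).2.
have ep0 x : 0 < ep x by case: (svalP x).
pose refines j (x y : S) :=
  [/\ (forall w, D (fw x w) (fw y w) < ep x), (forall w, D (bw x w) (bw y w) < ep x),
      ep y <= ep x / 2 &
      forall H, (forall w, D (fw y w) (H w) <= 2 * ep y) -> O j H].
have /choice[next hnext'] : forall jx : nat * S, exists y, refines jx.1 jx.2 y.
  move=> [j x]; have [Cx x0] := svalP x.
  have [G [G' [CG hG hG' [d d0 hd]]]] := dens _ _ j _ Cx x0.
  have m0 : 0 < Num.min (ep x / 2) (d / 3) by rewrite lt_min !divr_gt0// ep0.
  exists (exist _ (G, G', Num.min (ep x / 2) (d / 3)) (conj CG m0)).
  split=> //=; first by rewrite /ep /= ge_min lexx.
  move=> H hH; apply: hd => w; apply: le_lt_trans (hH w) _; rewrite /ep /=.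
  have : Num.min (ep x / 2) (d / 3) <= d / 3 by rewrite ge_min lexx orbT.
  by rewrite /ep; lra.
have hnext j x : refines j x (next (j, x)) := hnext' (j, x).
pose s := fix s n : S := if n is m.+1 then next (m, s m)
  else exist _ (F0, F0', 1) (conj C0 ltr01).
have ep_half n : ep (s n.+1) <= ep (s n) / 2 by case: (hnext n (s n)).
have ep_geo n : ep (s n) <= 2^-1 ^+ n.
  elim: n => [|n IH]; first by rewrite expr0.
  by apply: le_trans (ep_half n) _; rewrite exprSr ler_pM2r// invr_gt0.
have ep_small (e : R) : 0 < e -> exists N, forall n, (N <= n)%N -> 2 * ep (s n) < e.
  move=> e0; have h2 : 0 <= (2^-1 : R) < 1 by lra.
  have [N hN] := geometric_lt 2 e0 h2; exists N => n Nn.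
  apply: le_lt_trans hN; rewrite ler_pM2l//; apply: le_trans (ep_geo n) _.
  rewrite -[n in leLHS](subnK Nn) exprD ger_pMl ?exprn_gt0 ?invr_gt0//.
  by apply: exprn_ile1; lra.
have limit (h : S -> W -> W) :
    (forall n w, D (h (s n) w) (h (s n.+1) w) < ep (s n)) ->
    exists F, forall n w, D (h (s n) w) (F w) <= 2 * ep (s n).
  move=> hstep.
  have tail n k w : D (h (s n) w) (h (s (n + k)%N) w) <= 2 * ep (s n) - 2 * ep (s (n + k)%N).
    elim: k => [|k IH]; first by rewrite addn0 (mz_xx DM) subrr.
    have := mz_tri DM (h (s (n + k)%N) w) (h (s n) w) (h (s (n + k.+1)%N) w).
    have := hstep (n + k)%N w; have := ep_half (n + k)%N.
    by rewrite addnS; lra.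
  have tail' n m w : (n <= m)%N -> D (h (s n) w) (h (s m) w) <= 2 * ep (s n).
    move=> nm; have := tail n (m - n)%N w; rewrite subnKC//.
    by have := ep0 (s m); lra.
  have /choice[F hF] : forall w, exists l, forall e : R, 0 < e ->
      exists N, forall n, (N <= n)%N -> D (h (s n) w) l < e.
    move=> w; apply: (mz_complete DM) => // e e0.
    have e20 : 0 < e / 2 by rewrite divr_gt0.
    have [N hN] := ep_small _ e20; exists N => n m Nn Nm.
    have := mz_tri DM (h (s N) w) (h (s n) w) (h (s m) w).
    have := tail' _ _ w Nn; have := tail' _ _ w Nm; have := hN N (leqnn N).
    by rewrite (mz_sym DM (h (s n) w) (h (s N) w)); lra.
  exists F => n w; apply/ler_addgt0Pr => e e0.
  have [N hN] := hF w e e0.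
  have := mz_tri DM (h (s (maxn n N)) w) (h (s n) w) (F w).
  have := hN _ (leq_maxr n N); have := tail' _ _ w (leq_maxl n N).
  by lra.
have [F hF] := limit fw (fun n w => let: And4 h _ _ _ := hnext n (s n) in h w).
have [F' hF'] := limit bw (fun n w => let: And4 _ h _ _ := hnext n (s n) in h w).
exists F, F'; split=> [j|e e0].
  by have [_ _ _ h] := hnext j (s j); apply: h => w; exact: hF j.+1 w.
have [N hN] := ep_small e e0; have hNN := hN N (leqnn N).
exists (fw (s N)), (bw (s N)); split.
- by case: (svalP (s N)).
- by move=> w; rewrite (mz_sym DM); apply: le_lt_trans hNN.
- by move=> w; rewrite (mz_sym DM); apply: le_lt_trans hNN.
Qed.

Lemma uniform_limit_continuous (F : W -> W) :
  (forall e : R, 0 < e -> exists2 G, continuous G & forall w, D (F w) (G w) < e) ->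
  continuous F.
Proof.
move=> h; apply/(continuousP_eps DM DM) => x e e0.
have e30 : 0 < e / 3 by rewrite divr_gt0.
have [G /(continuousP_eps DM DM)/(_ x _ e30)[d d0 hd] hG] := h _ e30.
exists d => // y /hd xy; have := mz_tri DM (G x) (F x) (F y).
have := mz_tri DM (G y) (G x) (F y); have := hG x; have := hG y.
by rewrite (mz_sym DM (G y) (F y)); lra.
Qed.

Lemma uniform_limit_cancel (F F' : W -> W) : continuous F ->
  (forall e : R, 0 < e -> exists G G', [/\ cancel G' G,
     (forall w, D (F w) (G w) < e) & forall w, D (F' w) (G' w) < e]) ->
  cancel F' F.
Proof.
move=> Fc h w; apply: (mz_eq_lt DM) => e e0.
have e20 : 0 < e / 2 by rewrite divr_gt0.
have [d d0 hd] := compact_unif_continuous DM DM W_compact Fc e20.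
have m0 : 0 < Num.min d (e / 2) by rewrite lt_min d0.
have [G [G' [GK hG hG']]] := h _ m0.
have := hG' w; rewrite lt_min => /andP[/hd h1 _].
have := hG (G' w); rewrite lt_min GK => /andP[_ h2].
by have := mz_tri DM (F (G' w)) (F (F' w)) w; lra.
Qed.

Lemma uniform_limit_equivariant (F a : W -> W) : continuous a ->
  (forall e : R, 0 < e -> exists2 G, (forall w, G (a w) = a (G w)) &
     forall w, D (F w) (G w) < e) ->
  forall w, F (a w) = a (F w).
Proof.
move=> ac h w; apply: (mz_eq_lt DM) => e e0.
have e20 : 0 < e / 2 by rewrite divr_gt0.
have [d d0 hd] := compact_unif_continuous DM DM W_compact ac e20.
have m0 : 0 < Num.min d (e / 2) by rewrite lt_min d0.
have [G Ga hG] := h _ m0.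
have := hG w; rewrite lt_min => /andP[/hd h1 _].
have := hG (a w); rewrite lt_min Ga => /andP[_ h2].
have := mz_tri DM (a (G w)) (F (a w)) (a (F w)).
by rewrite (mz_sym DM (a (G w)) (a (F w))); lra.
Qed.

Section GenericConjugates.
Variables (G : zmodType) (rot : G -> W -> W) (I : eqType) (ls : seq I) (act : I -> W -> W).
Hypotheses (rot_c : forall g, continuous (rot g)) (rot0 : rot 0 = id)
  (rotD : forall g h w, rot (g + h) w = rot g (rot h w))
  (act_c : forall l, l \in ls -> continuous (act l))
  (rot_act : forall g l w, l \in ls -> rot g (act l w) = act l (rot g w)).
Hypothesis perturb : forall g0 (e : R) u (eu : R) (A : set nat),
  0 < e -> 0 < eu -> infinite_times A ->
  exists H H' : W -> W, exists2 g : G,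
    [/\ continuous H, continuous H', cancel H H', cancel H' H &
        forall l w, l \in ls -> H (act l w) = act l (H w)] &
    [/\ (forall w, D (H' (rot g (H w))) (rot g0 w) < e),
        (forall w, D (H' (rot (- g) (H w))) (rot (- g0) w) < e) &
        forall w, exists2 m, A m & D (H' (rot (g *+ m) (H w))) u < eu].

Definition conjugate_rotation (F F' : W -> W) := exists H H', exists2 g,
  [/\ continuous H, continuous H', cancel H H', cancel H' H &
      forall l w, l \in ls -> H (act l w) = act l (H w)] &
  (forall w, F w = H' (rot g (H w))) /\ (forall w, F' w = H' (rot (- g) (H w))).

Lemma comp3_continuous (f g h : W -> W) : continuous f -> continuous g -> continuous h ->
  continuous (fun w => f (g (h w))).
Proof.
move=> fc gc hc w; apply: (@continuous_comp _ _ _ (fun w => g (h w)) f); last exact: fc.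
by apply: (@continuous_comp _ _ _ h g); [exact: hc | exact: gc].
Qed.

Lemma conjugate_rotationP F F' : conjugate_rotation F F' ->
  [/\ continuous F, continuous F', cancel F F', cancel F' F &
      forall l w, l \in ls -> F (act l w) = act l (F w)].
Proof.
move=> [H [H' [g [Hc H'c HK H'K Heq] [/funext -> /funext ->]]]].
have H'eq l w : l \in ls -> H' (act l w) = act l (H' w).
  by move=> ll; rewrite -{1}(H'K w) -Heq// HK.
split; [exact: (comp3_continuous H'c (@rot_c g) Hc) |
        exact: (comp3_continuous H'c (@rot_c (- g)) Hc) | | |].
- by move=> w; rewrite H'K -rotD addNr rot0 HK.
- by move=> w; rewrite H'K -rotD subrr rot0 HK.
- by move=> l w ll; rewrite Heq// rot_act// H'eq.
Qed.

(** Conjugating [perturb] by [H] transfers it from a rotation to any conjugate of a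
    rotation, the targets and radii being moved by the uniform continuity of [H']. *)
Lemma conjugate_rotation_perturb F F' (e : R) u (eu : R) (A : set nat) :
  conjugate_rotation F F' -> 0 < e -> 0 < eu -> infinite_times A ->
  exists E E', [/\ conjugate_rotation E E', (forall w, D (F w) (E w) < e),
    (forall w, D (F' w) (E' w) < e) &
    forall w, exists2 m, A m & D (iter m E w) u < eu].
Proof.
move=> [H [H' [g0 [Hc H'c HK H'K Heq] [Fe F'e]]]] e0 eu0 hA.
have [d d0 hd] := compact_unif_continuous DM DM W_compact H'c e0.
have [d' d'0 hd'] := compact_unif_continuous DM DM W_compact H'c eu0.
have [E [E' [g [Ec E'c EK E'K Eeq] [h1 h2 h3]]]] := perturb g0 (H u) d0 d'0 hA.
exists (fun w => H' (E' (rot g (E (H w))))), (fun w => H' (E' (rot (- g) (E (H w))))).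
have iterE m w : iter m (fun w => H' (E' (rot g (E (H w))))) w =
    H' (E' (rot (g *+ m) (E (H w)))).
  elim: m => [|m IH]; first by rewrite mulr0n rot0 EK HK.
  by rewrite iterS IH H'K E'K -rotD -mulrS.
split.
- exists (E \o H), (H' \o E'); exists g => //; split.
  + by move=> w; apply: (@continuous_comp _ _ _ H E); [exact: Hc | exact: Ec].
  + by move=> w; apply: (@continuous_comp _ _ _ E' H'); [exact: E'c | exact: H'c].
  + by move=> w /=; rewrite EK HK.
  + by move=> w /=; rewrite H'K E'K.
  + by move=> l w ll /=; rewrite Heq// Eeq.
- by move=> w; rewrite Fe (mz_sym DM); exact: hd (h1 (H w)).
- by move=> w; rewrite F'e (mz_sym DM); exact: hd (h2 (H w)).
- move=> w; have [m Am hm] := h3 (H w); exists m => //.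
  by rewrite iterE -{1}(HK u); exact: hd' hm.
Qed.

(** Countably many conditions suffice: for each [i], that every orbit at times in
    [A i] approaches every point of a [1 / i.+1]-net.  The pairs ([i], position in
    the net) are enumerated by [unpickle]. *)
Lemma generic_equivariant_homeomorphism (A : nat -> set nat) :
  (forall i, infinite_times (A i)) ->
  exists F F', [/\ continuous F, continuous F', cancel F F', cancel F' F &
      forall l w, l \in ls -> F (act l w) = act l (F w)] /\
    forall i w u, exists2 m, A i m & D (iter m F w) u < 3 / i.+1%:R.
Proof.
move=> hA.
have ipos i : 0 < 1 / i.+1%:R :> R by rewrite divr_gt0.
have /choice[net hnet] : forall i, exists s : seq W, forall y,
    exists2 x, x \in s & D x y < 1 / i.+1%:R.
  by move=> i; exact: mz_totally_bounded.
pose O j F := forall i k u, unpickle j = Some (i, k) -> onth (net i) k = Some u ->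
  forall w, exists2 m, A i m & D (iter m F w) u < 2 * (1 / i.+1%:R).
have [|F F' j e CF e0|F [F' [OF apx]]] := @baire_limit conjugate_rotation O.
- exists (rot 0), (rot (- 0)), id, id, 0 => //.
  by split=> // w; exact: cvg_id.
- case ej : (@unpickle (nat * nat)%type j) => [[i k]|]; last first.
    exists F, F'; split=> //; [by move=> w; rewrite (mz_xx DM) |
      by move=> w; rewrite (mz_xx DM) |].
    by exists 1 => // E _ i k u; rewrite ej.
  case eu : (onth (net i) k) => [u|]; last first.
    exists F, F'; split=> //; [by move=> w; rewrite (mz_xx DM) |
      by move=> w; rewrite (mz_xx DM) |].
    by exists 1 => // E _ i' k' u'; rewrite ej => -[<- <-]; rewrite eu.
  have [E [E' [CE h1 h2 h3]]] := conjugate_rotation_perturb u CF e0 (ipos i) (hA i).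
  exists E, E'; split=> //.
  have [Ec _ _ _ _] := conjugate_rotationP CE.
  have [d d0 hd] := hitting_stability Ec (ipos i) h3.
  exists d => // H hH i' k' u'; rewrite ej => -[<- <-]; rewrite eu => -[<-].
  exact: hd.
have Fc : continuous F.
  apply: uniform_limit_continuous => e /apx[E [E' [/conjugate_rotationP[? _ _ _ _] ? _]]].
  by exists E.
have F'c : continuous F'.
  apply: uniform_limit_continuous => e /apx[E [E' [/conjugate_rotationP[_ ? _ _ _] _ ?]]].
  by exists E'.
exists F, F'; split.
  split=> //.
  - apply: uniform_limit_cancel => // e /apx[E [E' [/conjugate_rotationP[_ _ ? ? _] ? ?]]].
    by exists E', E.
  - apply: uniform_limit_cancel => // e /apx[E [E' [/conjugate_rotationP[_ _ ? ? _] ? ?]]].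
    by exists E, E'.
  - move=> l w ll; apply: (uniform_limit_equivariant (act_c ll)) => e.
    move=> /apx[E [E' [/conjugate_rotationP[_ _ _ _ ?] ? _]]].
    by exists E => // v; auto.
move=> i w u; have [x xs hx] := hnet i u.
have onx : onth (net i) (index x (net i)) = Some x.
  by rewrite onthE (nth_map x) ?index_mem// nth_index.
have [m Am hm] := OF (pickle (i, index x (net i))) i _ x (pickleK _) onx w.
exists m => //; have := mz_tri DM x (iter m F w) u.
have -> : 3 / i.+1%:R = 2 * (1 / i.+1%:R) + 1 / i.+1%:R :> R by ring.
by move=> h; apply: le_lt_trans h _; exact: ltrD.
Qed.

End GenericConjugates.

End UniformLimits.

(** * The space of orbits of a finite group *)

Section OrbitSpaceMetric.
Variables (R : realType) (W : topologicalType) (D : W -> W -> R).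
Hypotheses (DM : metrizes D) (W_compact : compact [set: W]).
Variables (I : zmodType) (L : set I) (ls : seq I) (act : I -> W -> W).
Hypotheses (Lls : forall l, L l <-> l \in ls) (ls_uniq : uniq ls) (ls0 : 0 \in ls)
  (lsB : forall x y, x \in ls -> y \in ls -> x - y \in ls).
Hypotheses (act_c : forall l, l \in ls -> continuous (act l)) (act0 : act 0 = id)
  (actD : forall l m w, l \in ls -> m \in ls -> act (l + m) w = act l (act m w)).

Let Y := orbit_space L act.

Definition proj (w : W) : Y := \pi_Y%qT w.

Let lsN x : x \in ls -> - x \in ls.
Proof. by move=> xl; rewrite -sub0r lsB. Qed.

Let lsD x y : x \in ls -> y \in ls -> x + y \in ls.
Proof. by move=> xl yl; rewrite -[y]opprK lsB ?lsN. Qed.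

Lemma projK (y : Y) : proj (repr y) = y.
Proof. exact: reprK. Qed.

Lemma proj_eqP w w' : proj w = proj w' <-> exists2 l, l \in ls & w' = act l w.
Proof.
have -> : proj w = proj w' <-> orbit_of L act w = orbit_of L act w'.
  rewrite /proj; split=> [/eqquotP/asboolP//|h]; apply/eqquotP.
  by apply/asboolP.
split=> [h|[l ll ->]].
  have : orbit_of L act w' w' by exists 0; rewrite ?act0//; apply/Lls.
  by rewrite -h => -[l /Lls ll <-]; exists l.
apply/seteqP; split=> _ [m /Lls ml <-].
  exists (m - l); first by apply/Lls; exact: lsB.
  by rewrite -actD ?lsB// subrK.
by exists (m + l); [apply/Lls; exact: lsD | rewrite actD].
Qed.

(** Summing the distance over the group makes it invariant, so that the distance of
    two orbits below is a genuine metric. *)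
Definition orbit_sum_dist (w w' : W) : R := \sum_(l <- ls) D (act l w) (act l w').

Let dh := orbit_sum_dist.

Lemma orbit_sum_dist_act m w w' : m \in ls -> dh (act m w) (act m w') = dh w w'.
Proof.
move=> ml; rewrite /dh /orbit_sum_dist.
have perm : perm_eq [seq l + m | l <- ls] ls.
  apply: uniq_perm => //; first by rewrite map_inj_uniq//; exact: addIr.
  move=> l; apply/mapP/idP => [[k kl ->]|ll]; first exact: lsD.
  by exists (l - m); rewrite ?subrK// lsB.
rewrite -[RHS](perm_big _ perm) /= big_map big_seq [RHS]big_seq.
by apply: eq_bigr => l ll; rewrite !actD.
Qed.

Lemma orbit_sum_dist_ge w w' : D w w' <= dh w w'.
Proof.
rewrite /dh /orbit_sum_dist (big_rem 0)//= act0 lerDl sumr_ge0// => l _.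
exact: mz_ge0 DM _ _.
Qed.

Lemma orbit_sum_metrizes : metrizes dh.
Proof.
have ge0 w w' : 0 <= dh w w' := le_trans (mz_ge0 DM w w') (orbit_sum_dist_ge w w').
split=> [w|w w' h|w w'|v w u|w A].
- by apply: big1_seq => l _; rewrite (mz_xx DM).
- apply: (mz_eq DM); apply/eqP; rewrite eq_le (mz_ge0 DM) andbT -h.
  exact: orbit_sum_dist_ge.
- by apply: eq_bigr => l _; rewrite (mz_sym DM).
- by rewrite -big_split; apply: ler_sum => l _; exact: mz_tri DM _ _ _.
split=> [/(mz_nbhs DM)[e e0 h]|[e e0 h]].
  by exists e => // v wv; apply: h; apply: le_lt_trans wv; exact: orbit_sum_dist_ge.
have s0 : 0 < (size ls)%:R :> R by rewrite ltr0n; case: (ls) ls0.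
have es0 : 0 < e / (size ls)%:R by rewrite divr_gt0.
have /choice[d hd] : forall l, exists d : R, 0 < d /\ (l \in ls ->
    forall v, D w v < d -> D (act l w) (act l v) < e / (size ls)%:R).
  move=> l; have [ll|_] := boolP (l \in ls); last by exists 1.
  have [d d0 hd] := (continuousP_eps DM DM (act l)).1 (act_c ll) w _ es0.
  by exists d.
have [r r0 hr] := @seq_min_pos R I ls d (fun l _ => (hd l).1).
apply/(mz_nbhs DM); exists r => // v wv; apply: h.
have -> : e = \sum_(l <- ls) (e / (size ls)%:R).
  rewrite big_const_seq count_predT iter_addr addr0 -[RHS]mulr_natr divfK//.
  by rewrite gt_eqF.
rewrite /dh /orbit_sum_dist big_seq [ltRHS]big_seq; apply: ltr_sum.
  by apply/hasP; exists 0; rewrite ?ls0.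
by move=> l ll; apply: (hd l).2 => //; apply: lt_le_trans wv (hr l ll).
Qed.

Definition orbit_dist (y y' : Y) : R :=
  inf [set r | exists w w', [/\ proj w = y, proj w' = y' & r = dh w w']].

Let dh_ge0 w w' : 0 <= dh w w' := mz_ge0 orbit_sum_metrizes w w'.

Let orbit_dist_inf y y' :
  has_inf [set r | exists w w', [/\ proj w = y, proj w' = y' & r = dh w w']].
Proof.
split; first by exists (dh (repr y) (repr y')), (repr y), (repr y'); rewrite !projK.
by exists 0 => _ [w [w' [_ _ ->]]].
Qed.

Lemma orbit_dist_le w w' : orbit_dist (proj w) (proj w') <= dh w w'.
Proof. by apply: ge_inf; [case: (orbit_dist_inf (proj w) (proj w')) | exists w, w']. Qed.

Lemma orbit_dist_ge0 y y' : 0 <= orbit_dist y y'.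
Proof.
by apply: lb_le_inf; [case: (orbit_dist_inf y y') | move=> _ [w [w' [_ _ ->]]]].
Qed.

(** By invariance the infimum may be taken over one orbit with the point [w] of the
    other fixed. *)
Lemma orbit_dist_lt w y (e : R) : orbit_dist (proj w) y < e ->
  exists2 w', proj w' = y & dh w w' < e.
Proof.
move=> /(inf_lt (orbit_dist_inf _ _).1)[_ [v [v' [/esym/proj_eqP[l ll ->] yv' ->]]] h].
exists (act (- l) v'); last by rewrite -(orbit_sum_dist_act _ _ ll) -actD ?lsN// subrr act0.
by rewrite -yv'; apply/esym/proj_eqP; exists (- l); rewrite ?lsN.
Qed.

Lemma proj_continuous : continuous proj.
Proof. exact: pi_continuous. Qed.

Lemma orbit_dist_metrizes : metrizes orbit_dist.
Proof.
have DH := orbit_sum_metrizes.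
have tri y x z : orbit_dist x z <= orbit_dist x y + orbit_dist y z.
  apply/ler_addgt0Pr => e e0; have e20 : 0 < e / 2 by rewrite divr_gt0.
  rewrite -(projK x).
  have [v yv hv] : exists2 v, proj v = y & dh (repr x) v < orbit_dist (proj (repr x)) y + e / 2.
    by apply: orbit_dist_lt; rewrite ltrDl.
  have [u zu hu] : exists2 u, proj u = z & dh v u < orbit_dist (proj v) z + e / 2.
    by apply: orbit_dist_lt; rewrite ltrDl.
  rewrite -{1}zu; apply: le_trans (orbit_dist_le _ _) _.
  by have := mz_tri DH v (repr x) u; rewrite yv in hu; rewrite -/dh; lra.
split=> //.
- move=> y; apply/eqP; rewrite eq_le orbit_dist_ge0 andbT -(projK y).
  by rewrite -(mz_xx DH (repr y)) orbit_dist_le.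
- move=> x y xy0.
  pose Q l (e : R) := dh (repr x) (act l (repr y)) < e.
  have [l ll hl] : exists2 l, l \in ls & forall e, 0 < e -> Q l e.
    apply: eps_pigeonhole => [l e e' h ee'|e e0]; first exact: lt_le_trans ee'.
    have [w yw hw] : exists2 w, proj w = y & dh (repr x) w < e.
      by apply: orbit_dist_lt; rewrite projK xy0.
    have [l ll wl] := (proj_eqP (repr y) w).1 (etrans (projK y) (esym yw)).
    by exists l; rewrite // /Q -wl.
  have xl := mz_eq_lt DH hl.
  by rewrite -(projK x) -(projK y); apply/esym/proj_eqP; exists l.
- move=> x y; congr inf; apply/seteqP; split=> _ [w [w' [h1 h2 ->]]];
    by exists w', w; rewrite h1 h2 (mz_sym DH).
move=> y A; rewrite -(projK y); split.
  move=> /proj_continuous/(mz_nbhs DH)[e e0 h]; exists e => // x.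
  by move=> /orbit_dist_lt[w <- hw]; exact: h.
move=> [e e0 h]; rewrite nbhsE.
exists [set x | orbit_dist (proj (repr y)) x < e]; last by move=> x /h.
split; last by rewrite /= (le_lt_trans (orbit_dist_le _ _))// (mz_xx DH).
rewrite /open /= /quotient_open.
rewrite openE => w /= hw; apply/(mz_nbhs DH).
exists (e - orbit_dist (proj (repr y)) (proj w)); first by rewrite subr_gt0.
move=> v hv; have := tri (proj w) (proj (repr y)) (proj v).
by have := orbit_dist_le w v; rewrite /= -/dh; lra.
Qed.

Lemma orbit_space_compact : compact [set: Y].
Proof.
have -> : [set: Y] = proj @` [set: W].
  by apply/seteqP; split=> // y _; exists (repr y) => //; exact: projK.
apply: continuous_compact => //; apply: continuous_subspaceT.
exact: proj_continuous.
Qed.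

Definition orbit_map (F : W -> W) (y : Y) : Y := proj (F (repr y)).

Section Descent.
Variable F : W -> W.
Hypothesis F_eq : forall l w, l \in ls -> F (act l w) = act l (F w).

Lemma orbit_map_proj w : orbit_map F (proj w) = proj (F w).
Proof.
rewrite /orbit_map; apply/esym/proj_eqP.
have [l ll ->] := (proj_eqP w (repr (proj w))).1 (esym (projK _)).
by exists l => //; rewrite F_eq.
Qed.

Lemma orbit_map_iter m w : iter m (orbit_map F) (proj w) = proj (iter m F w).
Proof. by elim: m => [//|m IH]; rewrite !iterS IH orbit_map_proj. Qed.

Lemma orbit_map_continuous : continuous F -> continuous (orbit_map F).
Proof.
move=> Fc; apply/quotient_continuous.
have -> : orbit_map F \o \pi_Y%qT = proj \o F.
  by apply/funext => w; exact: orbit_map_proj.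
by move=> w; apply: continuous_comp; [exact: Fc | exact: proj_continuous].
Qed.

End Descent.

Lemma orbit_map_homeomorphism (F F' : W -> W) : continuous F -> continuous F' ->
  cancel F F' -> cancel F' F ->
  (forall l w, l \in ls -> F (act l w) = act l (F w)) ->
  homeomorphism (orbit_map F).
Proof.
move=> Fc F'c FK F'K Feq.
have F'eq l w : l \in ls -> F' (act l w) = act l (F' w).
  by move=> ll; rewrite -{1}(F'K w) -Feq// FK.
exists (orbit_map F'); split; [exact: orbit_map_continuous |
  exact: orbit_map_continuous | |] => y; rewrite -(projK y) !orbit_map_proj//.
  by rewrite FK.
by rewrite F'K.
Qed.

End OrbitSpaceMetric.

(** * Minimality of products with a non-compact factor *)

Section MinimalProducts.
Variables (R : realType) (X : topologicalType) (T : X -> X).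
Hypothesis T_minimal : minimal_system T.

Lemma minimal_tail_dense (x0 : X) N :
  closure [set iter n T x0 | n in [set n | (N <= n)%N]] = [set: X].
Proof.
have [Tc Tmin] := T_minimal; set O := [set _ | _ in _].
apply: Tmin; first exact: closed_closure.
  by exists (iter N T x0); apply: subset_closure; exists N => /=.
move=> _ [x xO <-] B /Tc/xO[_ [[n Nn <-] hB]].
by exists (iter n.+1 T x0); split=> //; exists n.+1 => //=; exact: leqW.
Qed.

Lemma minimal_returns (d : X -> X -> R) (x0 : X) (e : R) N : metrizes d -> 0 < e ->
  infinite_times [set n | (N <= n)%N /\ d (iter n T x0) x0 < e].
Proof.
move=> dM e0 m.
have : closure [set iter n T x0 | n in [set n | (maxn m N <= n)%N]] x0.
  by rewrite minimal_tail_dense.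
move=> /(_ _ (mz_ball dM x0 e0))[_ [[n hn <-] /= hd]].
move: hn; rewrite /= geq_max => /andP[mn Nn]; exists n => //; split=> //.
by rewrite (mz_sym dM).
Qed.

(** The factor that is projected away is compact. *)
Lemma projection_closed (Y : topologicalType) (M : set (X * Y)) :
  compact [set: Y] -> closed M -> closed (fst @` M).
Proof.
move=> /compact_near_coveringP cY cM; rewrite -openC openE => x /= xM.
suff near_y y : [set: Y] y ->
    \forall y' \near y & x' \near nbhs x, ~ M (x', y').
  have h := cY X (nbhs x) (fun x' y => ~ M (x', y)) _ near_y.
  rewrite /interior /=; move: (h (nbhs_filter x)).
  apply: (@filterS _ (nbhs x)) => x' hx' [[a b] Mab /= xa].
  by apply: (hx' b) => //; rewrite -xa.
move=> _; have nM : nbhs (x, y) (~` M).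
  by apply: open_nbhs_nbhs; split; [rewrite openC | move=> Mxy; apply: xM; exists (x, y)].
have [[U V] /= [nU nV] UV] := nM.
exists (V, U); first by split.
by move=> [b a] /= [Vb Ua]; exact: (UV (a, b)).
Qed.

(** A closed invariant set [M] projects onto [X], as the projection along a compact
    space is closed; so it contains a point over [x0].  Returns of [x0] during which
    the second coordinate becomes dense put the whole fibre of [x0] in [M], hence the
    fibre of each point of the orbit of [x0], which is dense. *)
Lemma product_minimal (Y : topologicalType) (S : Y -> Y) (x0 : X) :
  compact [set: Y] -> continuous S -> (forall y, exists z, S z = y) ->
  (forall (y z : Y) (U : set X) (V : set Y), nbhs x0 U -> nbhs z V ->
     exists2 m, U (iter m T x0) & V (iter m S y)) ->
  minimal_system (fun p : X * Y => (T p.1, S p.2)).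
Proof.
move=> cY Sc Ssurj hit; have [Tc Tmin] := T_minimal.
split.
  move=> p; apply: pair_continuous.
    by apply: (@continuous_comp _ _ _ fst T); [exact: cvg_fst | exact: Tc].
  by apply: (@continuous_comp _ _ _ snd S); [exact: cvg_snd | exact: Sc].
move=> M cM [p Mp] Minv.
have Miter m x y : M (x, y) -> M (iter m T x, iter m S y).
  by elim: m => [//|m IH] Mxy; apply: Minv; exists (iter m T x, iter m S y) => //; exact: IH.
have fstM : fst @` M = [set: X].
  apply: Tmin; first exact: projection_closed.
    by exists p.1, p.
  move=> _ [_ [[x y] Mxy <-] <-]; exists (T x, S y) => //.
  exact: (Miter 1%N).
have [[a y0] My0 /= a0] : (fst @` M) x0 by rewrite fstM.
rewrite {}a0 in My0.
have M0 y : M (x0, y).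
  apply: cM => B [[U V] /= [nU nV] UV].
  have [m Um Vm] := hit y0 y U V nU nV.
  by exists (iter m T x0, iter m S y0); split; [exact: Miter | exact: UV].
have Siter m y : exists z, iter m S z = y.
  elim: m y => [|m IH] y; first by exists y.
  by have [z <-] := Ssurj y; have [v <-] := IH z; exists v.
apply/seteqP; split=> // -[x y] _; apply: cM => B [[U V] /= [nU nV] UV].
have : closure [set iter n T x0 | n in [set n | (0 <= n)%N]] x by rewrite minimal_tail_dense.
move=> /(_ _ nU)[_ [[n _ <-] Un]].
have [z zy] := Siter n y.
exists (iter n T x0, y); split; first by rewrite -zy; exact: Miter.
by apply: UV; split=> //=; exact: nbhs_singleton.
Qed.

End MinimalProducts.

Theorem theorem28 (R : realType)
  (Gamma : topologicalZmodType)
  (Gamma_infinite : infinite_set [set: Gamma])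
  (Gamma_compact : compact [set: Gamma])
  (Gamma_connected : connected [set: Gamma])
  (Gamma_metrizable : metrizable R Gamma)
  (Lambda : set Gamma)
  (Lambda_finite : finite_set Lambda)
  (Lambda_subgroup : zmod_closed (mem Lambda))
  (Z : metricType R)
  (Z_compact : compact [set: Z])
  (Ga : set {uniform Z -> Z})
  (Ga_subgroup : homeo_subgroup Ga)
  (Ga_arc : arcwise_connected R Ga)
  (Ga_minimal : minimal_action Ga)
  (q : Gamma -> Z -> Z)
  (q_normalizer : forall l, Lambda l -> homeo_normalizer Ga (q l))
  (q_morphism : forall l m, Lambda l -> Lambda m -> q (l + m) = q l \o q m) :
  homeo_product_minimal R
    (orbit_space Lambda (diagonal_map q : Gamma -> Gamma * Z -> Gamma * Z)).
Proof.
have [rho [rhoP rhoM]] := compact_group_norm Gamma_compact Gamma_metrizable.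
have [s Ls] := (finite_seqP Lambda).1 Lambda_finite.
pose ls := undup s.
have Lls l : Lambda l <-> l \in ls by rewrite mem_undup Ls.
have ls_uniq : uniq ls := undup_uniq s.
have [L0 LB] := Lambda_subgroup.
have ls0 : 0 \in ls by apply/Lls; rewrite -in_setE.
have lsB x y : x \in ls -> y \in ls -> x - y \in ls.
  move=> /Lls xl /Lls yl; apply/Lls; rewrite -in_setE.
  by apply: LB; rewrite inE.
have q_homeo l : l \in ls -> homeomorphism (q l) by move=> /Lls/q_normalizer[].
have q_cont l : l \in ls -> continuous (q l) by move=> /q_homeo[k []].
have qD l m : l \in ls -> m \in ls -> q (l + m) = q l \o q m.
  by move=> /Lls ll /Lls ml; exact: q_morphism.
have q0 : q 0 = id.
  have [k [_ _ qk _]] := q_homeo 0 ls0.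
  apply/funext => z; apply: (can_inj qk).
  by have := qD 0 0 ls0 ls0; rewrite addr0 => /(congr1 (@^~ z)) /= <-.
have WM : metrizes (@wdist R Gamma rho Z) by exact: wdist_metrizes.
have Wc := compact_setT_prod Gamma_compact Z_compact.
pose act : Gamma -> Gamma * Z -> Gamma * Z := diagonal_map q.
have add_c (g : Gamma) : continuous (fun x : Gamma => g + x).
  move=> x; apply: (@continuous_comp _ _ _ (fun y : Gamma => (g, y))
    (fun p : Gamma * Gamma => p.1 + p.2)); last exact: add_continuous.
  by apply: pair_continuous; [exact: cvg_cst | exact: cvg_id].
have act_c l : l \in ls -> continuous (act l).
  move=> ll w.
  apply: (@pair_continuous _ _ _ (fun w : Gamma * Z => l + w.1) (fun w => q l w.2)).
    by apply: (@continuous_comp _ _ _ fst (fun x => l + x)); [exact: cvg_fst | exact: add_c].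
  by apply: (@continuous_comp _ _ _ snd (q l)); [exact: cvg_snd | exact: q_cont].
have act0 : act 0 = id.
  by apply/funext => -[x z]; rewrite /act /diagonal_map /= add0r q0.
have actD l m w : l \in ls -> m \in ls -> act (l + m) w = act l (act m w).
  by move=> ll ml; rewrite /act /diagonal_map /= addrA qD.
have YM := orbit_dist_metrizes WM Lls ls_uniq ls0 lsB act_c act0 actD.
have Yc : compact [set: orbit_space Lambda act] by exact: orbit_space_compact.
split=> //; first exact: mz_metrizable YM.
move=> X T X_metrizable T_minimal.
have [[x0 _]|X0] := pselect ([set: X] !=set0); last first.
  exists id; first by exists id; split=> // y; exact: cvg_id.
  split; first by move=> [x y]; exfalso; apply: X0; exists x.
  by move=> M _ [[x y] _]; exfalso; apply: X0; exists x.
have [d dM] := metrizable_metrizes X_metrizable.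
pose A i := [set n | (i <= n)%N /\ d (iter n T x0) x0 < 1 / i.+1%:R].
have hA i : infinite_times (A i).
  by apply: (minimal_returns T_minimal) => //; rewrite divr_gt0.
have rot_c g : continuous (@rot R Gamma Z g).
  move=> w; apply: (@pair_continuous _ _ _ (fun w : Gamma * Z => g + w.1) snd);
    last exact: cvg_snd.
  by apply: (@continuous_comp _ _ _ fst (fun x => g + x)); [exact: cvg_fst | exact: add_c].
have rot0 : @rot R Gamma Z 0 = id.
  by apply/funext => -[x z]; rewrite /rot /= add0r.
have rotD g h w : @rot R Gamma Z (g + h) w = rot g (rot h w).
  by rewrite /rot /= addrA.
have rot_act g l w : l \in ls -> @rot R Gamma Z g (act l w) = act l (rot g w).
  by move=> ll; rewrite /rot /act /diagonal_map /= addrCA.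
have perturb := rotation_perturbation rhoP rhoM Gamma_compact Gamma_connected
  Gamma_infinite Z_compact ls_uniq ls0 lsB q_cont qD q0 Ga_subgroup Ga_arc Ga_minimal.
have [F [F' [[Fc F'c FK F'K Feq] hit]]] : exists F F', [/\ continuous F, continuous F',
      cancel F F', cancel F' F & forall l w, l \in ls -> F (act l w) = act l (F w)] /\
    forall i w u, exists2 m, A i m & wdist rho (iter m F w) u < 3 / i.+1%:R.
  exact: (generic_equivariant_homeomorphism WM Wc rot_c rot0 rotD act_c rot_act).
have S_homeo := orbit_map_homeomorphism Lls ls0 lsB act0 actD Fc F'c FK F'K Feq.
exists (orbit_map F) => //; have [S' [Sc _ _ S'K]] := S_homeo.
apply: (product_minimal T_minimal (x0 := x0)) => //.
  by move=> y; exists (S' y).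
move=> y z U V /(mz_nbhs dM)[e e0 hU]; rewrite -(projK y) -(projK z).
move=> /proj_continuous/(mz_nbhs WM)[e' e'0 hV].
have m0 : 0 < Num.min e e' by rewrite lt_min e0.
pose i := Num.truncn (3 / Num.min e e').
have i3 : 3 / i.+1%:R < Num.min e e'.
  rewrite ltr_pdivrMr// mulrC -ltr_pdivrMr//.
  exact: truncnS_gt.
move: i3; rewrite lt_min => /andP[ie ie'].
have [m [im dm] hm] := hit i (repr y) (repr z).
exists m.
  apply: hU; rewrite (mz_sym dM); apply: lt_le_trans dm _; apply/ltW.
  by apply: le_lt_trans ie; rewrite ler_pM2r ?invr_gt0// ler1n.
rewrite (orbit_map_iter Lls ls0 lsB act0 actD Feq).
by apply: hV; rewrite (mz_sym WM); exact: lt_trans hm ie'.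
Qed.
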